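(* Let $M$ be a separable $\mathrm{II}_1$ factor with its unique faithful normal tracial state $\tau$. For any integer $n\geq 2$, equip $(M_{s.a.})_1^{\oplus n}$ (the set of $n$-tuples $x=(x_1,\dots,x_n)$ of self-adjoint elements of $M$ of operator norm at most $1$) with the metric \[ d(x,y)=\max_{1\leq i\leq n}\|x_i-y_i\|_2 . \] Then the set \[ \{x\in (M_{s.a.})_1^{\oplus n} : W^*(x)\leq M \text{ is irreducible}\} \] is a dense $G_\delta$ set in this metric space.
   Context: $M_{s.a.}:=\{x\in M: x=x^*\}$, $(M)_1:=\{x\in M:\|x\|\leq 1\}$ (operator norm), $(M_{s.a.})_1:=M_{s.a.}\cap (M)_1$. $\|x\|_2:=\tau(x^*x)^{1/2}$. $W^*(x)$ denotes the (unital) von Neumann subalgebra of $M$ generated by the entries $x_1,\dots,x_n$. A unital inclusion of von Neumann algebras $N\leq M$ is irreducible if $N'\cap M=\mathbb{C}$. Separable means that $M$ has separable predual (equivalently, $L^2(M,\tau)$ is a separable Hilbert space). *)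

(* Defs.v *)
From HB Require Import structures.
From mathcomp Require Import all_boot all_order all_algebra.
From mathcomp Require Import complex.
From mathcomp Require Import all_classical all_reals all_analysis borel_hierarchy.

Set Implicit Arguments.
Unset Strict Implicit.
Unset Printing Implicit Defensive.
Import Order.TTheory GRing.Theory Num.Theory numFieldNormedType.Exports.
Local Open Scope classical_set_scope.
Local Open Scope ring_scope.
Local Open Scope complex_scope.

(* Complex Hilbert spaces; the inner product is linear in its first argument
   and conjugate-linear in its second. *)
HB.mixin Record CompleteNormedModule_isHilbert (R : realType) H
    of CompleteNormedModule R[i] H := {
  hdot : {dot H for Num.conj} ;
  hdotE : forall u : H, `|u| ^+ 2 = hdot u u
}.

#[short(type="hilbertType")]
HB.structure Definition Hilbert (R : realType) :=
  {H of CompleteNormedModule_isHilbert R H & CompleteNormedModule R[i] H}.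

Section operators.
Context {R : realType} {H : hilbertType R}.
Implicit Types (x y p : H -> H) (S M : set (H -> H)).

Definition bounded_op x : Prop := linear x /\ continuous x.

Definition opnorm x : R := sup [set complex.Re `|x u| | u in [set u | `|u| <= 1]].

Definition is_adjoint x y : Prop :=
  forall u v, hdot (x u) v = hdot u (y v).

(* The adjoint is unique, and exists for every bounded operator; the default
   value 0 is never used below. *)
Definition adj x : H -> H := xget (fun=> 0) [set y | is_adjoint x y].

Definition scalars : set (H -> H) := [set x | exists a : R[i], x = *:%R a].

(* x <= y as quadratic forms: the order of R[i] forces <(y - x)u, u> to be
   real and nonnegative. *)
Definition op_le x y : Prop := forall u, 0 <= hdot (y u - x u) u.

Definition commutant S : set (H -> H) :=
  [set y | bounded_op y /\ forall x, S x -> y \o x = x \o y].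

(* By the bicommutant equation M is a unital algebra of bounded operators,
   closed in the weak operator topology. *)
Definition von_neumann_algebra M : Prop :=
  (forall x, M x -> exists2 y, is_adjoint x y & M y) /\
  commutant (commutant M) = M.

Definition factor M : Prop :=
  [/\ von_neumann_algebra M, exists u : H, u != 0
    & M `&` commutant M = scalars].

Definition projection p : Prop := adj p = p /\ p \o p = p.

Definition abelian_projection M p : Prop :=
  [/\ M p, projection p
    & forall x y, M x -> M y ->
        (p \o x \o p) \o (p \o y \o p) = (p \o y \o p) \o (p \o x \o p)].

Definition finite_algebra M : Prop :=
  forall x, M x -> adj x \o x = id -> x \o adj x = id.

Definition II1_factor M : Prop :=
  [/\ factor M, finite_algebra M
    & forall p, abelian_projection M p -> p = (fun=> 0)].

Definition sa_part M : set (H -> H) := [set x | M x /\ x = adj x].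

Definition sa_ball M : set (H -> H) := [set x | sa_part M x /\ opnorm x <= 1].

Definition directed (D : set (H -> H)) : Prop :=
  D !=set0 /\
  forall x y, D x -> D y -> exists z, [/\ D z, op_le x z & op_le y z].

Definition op_supremum M (D : set (H -> H)) x : Prop :=
  [/\ sa_part M x, forall d, D d -> op_le d x
    & forall y, sa_part M y -> (forall d, D d -> op_le d y) -> op_le x y].

(* A functional on M is represented by a function on all of H -> H, of which
   only the values on M matter. *)
Implicit Type tau : (H -> H) -> R[i].

Definition state M tau : Prop :=
  [/\ forall a x y, M x -> M y -> tau (a *: x + y) = a * tau x + tau y,
      forall x, M x -> 0 <= tau (adj x \o x)
    & tau id = 1].

Definition normal M tau : Prop :=
  forall D x, D `<=` sa_part M -> directed D -> op_supremum M D x ->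
    supremums (tau @` D) (tau x).

Definition faithful M tau : Prop :=
  forall x, M x -> tau (adj x \o x) = 0 -> x = (fun=> 0).

Definition tracial M tau : Prop :=
  forall x y, M x -> M y -> tau (x \o y) = tau (y \o x).

Definition norm2 tau x : R := Num.sqrt (complex.Re (tau (adj x \o x))).

(* L2 is the completion of M for the inner product (x, y) |-> tau (y^* x), with
   L the canonical map. *)
Definition is_L2 M tau (L2 : hilbertType R) (L : (H -> H) -> L2) : Prop :=
  [/\ forall a x y, M x -> M y -> L (a *: x + y) = a *: L x + L y,
      forall x y, M x -> M y -> hdot (L x) (L y) = tau (adj y \o x)
    & dense (L @` M)].

Definition separable_algebra M tau : Prop :=
  exists (L2 : hilbertType R) (L : (H -> H) -> L2),
    is_L2 M tau L /\ exists D : set L2, countable D /\ dense D.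

Definition subalgebra M N : Prop := von_neumann_algebra N /\ N `<=` M.

Definition Wstar M (S : set (H -> H)) : set (H -> H) :=
  smallest (subalgebra M) S.

Definition irreducible M N : Prop := commutant N `&` M = scalars.

End operators.

(* T with the topology whose open sets are those containing a d-ball around each
   of their points: the metric topology when d is a distance. *)
Definition dist_space {R : realType} {T : Type} (d : T -> T -> R) : Type := T.

Section dist_topology.
Context {R : realType} {T : choiceType} (d : T -> T -> R).

HB.instance Definition _ := Choice.on (dist_space d).

Definition dist_open (U : set (dist_space d)) : Prop :=
  forall x, U x -> exists2 e : R, 0 < e & forall y, d x y < e -> U y.

Let dist_openT : dist_open setT.
Proof. by move=> x _; exists 1. Qed.

Let dist_openI (A B : set (dist_space d)) :
  dist_open A -> dist_open B -> dist_open (A `&` B).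
Proof.
move=> oA oB x [/oA[e e0 eA] /oB[f f0 fB]].
exists (Num.min e f); first by rewrite lt_min e0.
by move=> y; rewrite lt_min => /andP[/eA ? /fB].
Qed.

Let dist_open_bigU (I : Type) (f : I -> set (dist_space d)) :
  (forall i, dist_open (f i)) -> dist_open (\bigcup_i f i).
Proof.
move=> of_ x [i _ /of_[e e0 ef]]; exists e => // y /ef fy.
by exists i.
Qed.

HB.instance Definition _ := isOpenTopological.Build (dist_space d)
  dist_openT dist_openI dist_open_bigU.

End dist_topology.

Definition dist2 {R : realType} {H : hilbertType R} (M : set (H -> H))
    (tau : (H -> H) -> R[i]) (n : nat) (x y : 'I_n -> sa_ball M) : R :=
  \big[Num.max/0]_(i < n) norm2 tau (\val (x i) - \val (y i)).

(* Main.v *)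
(* Write X for the self-adjoint unit ball with the 2-norm.  Since the
   generators are self-adjoint, W^*(x) is irreducible iff only scalars of X
   commute with every x_i.

   G_delta: if w in a closed convex subset K of X nearly commutes with x, in the
   2-norm and to every precision, then some w in K commutes with x; hence the
   tuples x commuting with some element of K form a closed set.  Letting K range
   over X intersected with small balls around a countable dense set gives
   countably many closed sets, and x is irreducible iff it avoids those among
   them whose K contains no scalar.

   Density: let B be the centralizer in M of a subset of X.  By Baire, a generic
   h in X has the property that the centralizer of h in B varies continuously at
   h.  Differentiating [h + r h', y_r] = 0 at such an h shows that if y in B
   commutes with h and tau([h, b] k) = 0 for all b in B, then
   tau([h', y] k) = 0 for all h', that is, [y, k] = 0.  With B = M and k
   commuting with h: the relative commutant of a generic h_1 is abelian.  With
   B = {h_1}' and k = [y, m]: for a generic h_2, each y commuting with h_1 and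
   h_2 satisfies [y, [y, m]] = 0 for all m in M, so y is central.

   Both parts need X to be complete.  For a fast Cauchy sequence x_k with
   differences d_k, the limits c of the resolvents of small multiples of
   sum_k 4^k d_k^2 are close to 1 in trace by normality, while the norms of
   d_k c are summable; thus x_k converges strongly and in the 2-norm. *)

Require Import Defs.
From HB Require Import structures.
From mathcomp Require Import all_boot all_order all_algebra.
From mathcomp Require Import complex.
From mathcomp Require Import all_classical all_reals all_analysis borel_hierarchy.
From mathcomp Require Import ring lra.
Set Implicit Arguments.
Unset Strict Implicit.
Unset Printing Implicit Defensive.
Import Order.TTheory GRing.Theory Num.Theory numFieldNormedType.Exports.
Local Open Scope classical_set_scope.
Local Open Scope ring_scope.
Local Open Scope complex_scope.

(** * Tracial algebras with a 2-norm complete unit ball *)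

Lemma invn_lt (R : realType) (e : R) : 0 < e ->
  exists n, forall k, (n <= k)%N -> k.+1%:R^-1 < e.
Proof.
move=> e0; have [n] := ltr_add_invr e0; rewrite add0r => ne.
exists n => k nk; apply: le_lt_trans ne.
by rewrite lef_pV2 ?posrE ?ltr0n// ler_nat.
Qed.

Section tracial_algebra.
Context {R : realType} {A : algType R}.
Variables (st : A -> A) (t : A -> R) (N : A -> R) (X : set A).

(* [A] is a complex *-algebra seen over the reals, [t] is the real part of its
   trace, and [X] plays the role of the self-adjoint unit ball. *)
Record tracial_ball : Prop := TracialBall {
  stD : {morph st : x y / x + y};
  stZ : forall a, {morph st : x / a *: x};
  stM : forall x y, st (x * y) = st y * st x;
  stK : involutive st;
  trD : {morph t : x y / x + y};
  trZ : forall a x, t (a *: x) = a * t x;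
  tr1 : t 1 = 1;
  trC : forall x y, t (x * y) = t (y * x);
  trS : forall x, t (st x) = t x;
  nrm_ge0 : forall x, 0 <= N x;
  nrmE : forall x, N x ^+ 2 = t (st x * x);
  nrm_eq0 : forall x, N x = 0 -> x = 0;
  nrmD : forall x y, N (x + y) <= N x + N y;
  nrmZ : forall a x, N (a *: x) = `|a| * N x;
  nrm_CS : forall x y, `|t (st y * x)| <= N x * N y;
  ball_sa : forall x, X x -> st x = x;
  ball_convex : forall a x y, X x -> X y -> 0 <= a <= 1 ->
    X (a *: x + (1 - a) *: y);
  ball_mul : forall x d, X x -> N (x * d) <= N d;
  ball_absorb : forall x, st x = x -> exists2 r, 0 < r & X (r *: x);
  ball_complete : forall w : nat -> A, (forall n, X (w n)) ->
    (forall e, 0 < e -> exists n, forall i j, (n <= i)%N -> (n <= j)%N ->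
      N (w i - w j) < e) ->
    exists2 x, X x & forall e, 0 < e -> exists n, forall i, (n <= i)%N ->
      N (w i - x) < e;
  ball_center : forall y, X y -> (forall m, X m -> y * m = m * y) ->
    exists a, y = a *: 1;
  imag_unit : exists J, [/\ J * J = -1, st J = - J & forall x, J * x = x * J]
}.

Hypothesis hX : tracial_ball.

(** * Elements of closed convex sets that commute with a tuple *)

Definition convex_set (K : set A) := forall a x y, K x -> K y -> 0 <= a <= 1 ->
  K (a *: x + (1 - a) *: y).

Definition nrm_closed (K : set A) := forall x,
  (forall e, 0 < e -> exists2 y, K y & N (y - x) < e) -> K x.

Definition comm (x y : A) := x * y - y * x.

Let trN x : t (- x) = - t x.
Proof. by rewrite -scaleN1r (trZ hX) mulN1r. Qed.

Let trB x y : t (x - y) = t x - t y.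
Proof. by rewrite (trD hX) trN. Qed.

Let tr0 : t 0 = 0.
Proof. by rewrite -[X in t X](subrr 0) trB subrr. Qed.

Let stN x : st (- x) = - st x.
Proof. by rewrite -scaleN1r (stZ hX) scaleN1r. Qed.

Let stB x y : st (x - y) = st x - st y.
Proof. by rewrite (stD hX) stN. Qed.

Let st1 : st 1 = 1.
Proof. by rewrite -[LHS]mul1r -{1}(stK hX 1) -(stM hX) mul1r (stK hX). Qed.

Let nrmN x : N (- x) = N x.
Proof. by rewrite -scaleN1r (nrmZ hX) normrN1 mul1r. Qed.

Let nrmC x y : N (x - y) = N (y - x).
Proof. by rewrite -nrmN opprB. Qed.

Let nrm_triangle z x y : N (x - y) <= N (x - z) + N (z - y).
Proof. by have := nrmD hX (x - z) (z - y); rewrite subrKA. Qed.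

Let nrm1 : N 1 = 1.
Proof.
have /eqP := nrmE hX 1; rewrite st1 mul1r (tr1 hX).
rewrite -[X in _ == X](expr1n R 2) eqrXn2 // => [/eqP//|].
exact: (nrm_ge0 hX).
Qed.

Let nrmS x : N (st x) = N x.
Proof.
apply/eqP; rewrite -(@eqrXn2 _ 2) ?(nrm_ge0 hX) // !(nrmE hX) (stK hX).
by rewrite (trC hX).
Qed.

Let parallelogram x y :
  N (x - y) ^+ 2 = 2 * N x ^+ 2 + 2 * N y ^+ 2 - N (x + y) ^+ 2.
Proof.
rewrite !(nrmE hX) stB (stD hX) !(mulrDl, mulrDr) !(mulrN, mulNr).
by rewrite !(trB, trD hX, trN); lra.
Qed.

Let ball_mulr x d : X x -> N (d * x) <= N d.
Proof.
move=> Xx; rewrite -nrmS (stM hX) (ball_sa hX Xx) -(nrmS d).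
exact: (ball_mul hX).
Qed.

Let ball_nrm x : X x -> N x <= 1.
Proof. by move=> Xx; rewrite -[x]mulr1 -nrm1; apply: (ball_mul hX). Qed.

Lemma nrm_comm_ball x d : X x -> N (comm x d) <= 2 * N d.
Proof.
move=> Xx; apply: (le_trans (nrmD hX _ _)); rewrite nrmN mulrDl mul1r.
by apply: lerD; [exact: (ball_mul hX) | exact: ball_mulr].
Qed.

Let commC x y : comm x y = - comm y x.
Proof. by rewrite /comm opprB. Qed.

Lemma comm_eq0 x y : comm x y = 0 -> x * y = y * x.
Proof. exact: subr0_eq. Qed.

(* Near-minimizers of the norm over the decreasing convex sets [C j] form a
   Cauchy sequence by the parallelogram law; this replaces weak compactness. *)
Lemma approx_commuting (I : Type) (K : set A) (x : I -> A) :
  convex_set K -> nrm_closed K -> K `<=` X -> (forall i, X (x i)) ->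
  (forall e, 0 < e -> exists2 w, K w & forall i, N (comm w (x i)) <= e) ->
  exists2 w, K w & forall i, comm w (x i) = 0.
Proof.
move=> Kc Kcl KX Xx Kx.
have commBl w w' i : comm (w - w') (x i) = comm w (x i) - comm w' (x i).
  by rewrite /comm mulrBl mulrBr !opprD !opprK addrACA.
pose C j : set A := [set w | K w /\ forall i, N (comm w (x i)) <= j.+1%:R^-1].
have C_mono i j : (i <= j)%N -> C j `<=` C i.
  move=> ij w [Kw wj]; split=> // k; apply: (le_trans (wj k)).
  by rewrite lef_pV2 ?posrE ?ltr0n// ler_nat.
have C_conv j : convex_set (C j).
  move=> a u v [Ku uj] [Kv vj] a01; split; first exact: Kc.
  move=> i; have [a0 a1] := andP a01.
  have -> : comm (a *: u + (1 - a) *: v) (x i) =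
            a *: comm u (x i) + (1 - a) *: comm v (x i).
    rewrite /comm mulrDl mulrDr -!scalerAl -!scalerAr !scalerBr opprD.
    by rewrite addrACA.
  apply: (le_trans (nrmD hX _ _)); rewrite !(nrmZ hX).
  rewrite (ger0_norm a0) ger0_norm ?subr_ge0//.
  have := uj i; have := vj i; set r := _^-1 => h1 h2.
  have a1' : 0 <= 1 - a by rewrite subr_ge0.
  by have := ler_wpM2l a0 h2; have := ler_wpM2l a1' h1; lra.
pose S j : set R := [set N w ^+ 2 | w in C j].
have S0 j : S j !=set0.
  have [|w Kw wx] := Kx j.+1%:R^-1; first by rewrite invr_gt0.
  by exists (N w ^+ 2), w.
have S_lb j : lbound (S j) 0 by move=> _ [w _ <-]; exact: sqr_ge0.
have S_inf j : has_inf (S j) by split=> //; exists 0; exact: S_lb.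
pose q j := inf (S j).
have qle j w : C j w -> q j <= N w ^+ 2.
  by move=> Cw; apply: ge_inf; [case: (S_inf j) | exists w].
have q_ub : ubound (range q) 1.
  move=> _ [j _ <-]; have [_ [w Cw _]] := S0 j.
  apply: (le_trans (qle _ _ Cw)); rewrite -(expr1n R 2) lerXn2r ?nnegrE//.
  - exact: (nrm_ge0 hX).
  - by apply/ball_nrm/KX; case: Cw.
have q_sup : has_sup (range q) by split; [exists (q 0%N), 0%N | exists 1].
pose s := sup (range q).
have qs j : q j <= s by apply: ub_le_sup; [exists 1 | exists j].
have : forall j, exists w, C j w /\ N w ^+ 2 <= q j + j.+1%:R^-1.
  move=> j; have j0 : 0 < (j.+1%:R^-1 : R) by rewrite invr_gt0.
  have [_ [w Cw <-] wj] := inf_adherent j0 (S_inf j).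
  by exists w; split=> //; apply: ltW.
move=> /choice[w wP].
have [||z Xz wz] := @ball_complete hX w.
- by move=> n; apply: KX; case: (wP n) => -[].
- move=> e e0.
  have e20 : 0 < e ^+ 2 / 16 by rewrite divr_gt0 // exprn_gt0.
  (* From [J] on the infima stay within [e ^+ 2 / 16] of [s]. The midpoint of [w i] and [w j] lies
     in [C J], so its squared norm is at least [q J], and the parallelogram law bounds the squared
     distance by [e ^+ 2 / 2]. *)
  have [_ [J _ <-] qJ] := sup_adherent e20 q_sup.
  have [n small] := invn_lt e20.
  exists (maxn J n) => i j; rewrite !geq_max => /andP[Ji ni] /andP[Jj nj].
  have [Ci wi] := wP i; have [Cj wj] := wP j.
  have : C J (2^-1 *: w i + (1 - 2^-1) *: w j).
    apply: C_conv; [exact: C_mono Ci | exact: C_mono Cj | lra].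
  have -> : (1 - 2^-1 : R) = 2^-1 by lra.
  move=> /qle; rewrite -scalerDr (nrmZ hX) exprMn ger0_norm ?invr_ge0// => qm.
  suff : N (w i - w j) ^+ 2 < e ^+ 2.
    by rewrite ltr_pXn2r ?nnegrE ?(nrm_ge0 hX) ?ltW.
  have := parallelogram (w i) (w j).
  have := small _ ni; have := small _ nj; have := qs i; have := qs j.
  rewrite -/s in qJ.
  move: qm qJ wi wj e20.
  have -> : (2^-1 ^+ 2 : R) = 4^-1 by field.
  set E := e ^+ 2; set a := i.+1%:R^-1; set b := j.+1%:R^-1.
  set a3 := N (w i + w j) ^+ 2; set a4 := N (w i - w j) ^+ 2.
  by move=> *; lra.
exists z.
  apply: Kcl => e /wz[n wn]; exists (w n); last exact: wn.
  by case: (wP n) => -[].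
move=> i; apply: (nrm_eq0 hX); apply/eqP; rewrite eq_le (nrm_ge0 hX) andbT.
apply/ler_addgt0Pr => e e0; rewrite add0r.
have [n wn] := wz _ (divr_gt0 e0 (ltr0n R 4)).
have [m /(_ _ (leq_maxr n m)) me] := invn_lt (divr_gt0 e0 (ltr0n R 2)).
have wk := wn _ (leq_maxl n m).
have [[_ /(_ i) wc] _] := wP (maxn n m); set k := maxn n m in wk wc me.
have -> : comm z (x i) = comm (z - w k) (x i) + comm (w k) (x i).
  by rewrite commBl subrK.
apply: (le_trans (nrmD hX _ _)).
have := nrm_comm_ball (z - w k) (Xx i).
rewrite commC nrmN [N (z - _)]nrmC; move: wc me wk.
by set a := k.+1%:R^-1; lra.
Qed.

Definition commuting_in (I : Type) (K : set A) (x : I -> A) :=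
  exists2 w, K w & forall i, comm w (x i) = 0.

Let commBr w x y : comm w (x - y) = comm w x - comm w y.
Proof. by rewrite /comm mulrBl mulrBr !opprD !opprK addrACA. Qed.

Let commZr a w x : comm w (a *: x) = a *: comm w x.
Proof. by rewrite /comm -scalerAl -scalerAr scalerBr. Qed.

Let commDr w x y : comm w (x + y) = comm w x + comm w y.
Proof. by rewrite /comm mulrDl mulrDr opprD addrACA. Qed.

(** By contraposition of [approx_commuting], a single [e] lies below some commutator norm for every
    [w] in [K]; moving the tuple by less than [e / 2] changes these commutators by less than [e]. *)
Lemma commuting_in_closed (I : Type) (K : set A) (x : I -> A) :
  convex_set K -> nrm_closed K -> K `<=` X -> (forall i, X (x i)) ->
  ~ commuting_in K x ->
  exists2 e, 0 < e & forall x' : I -> A, (forall i, X (x' i)) ->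
    (forall i, N (x i - x' i) < e) -> ~ commuting_in K x'.
Proof.
move=> Kc Kcl KX Xx nKx.
have [e e0 he] : exists2 e, 0 < e &
    forall w, K w -> exists i, e < N (comm w (x i)).
  apply: contrapT => h; apply: nKx; apply: approx_commuting => // e e0.
  apply: contrapT => h'; apply: h; exists e => // w Kw.
  apply: contrapT => h''; apply: h'; exists w => // i.
  by rewrite leNgt; apply/negP => ?; apply: h''; exists i.
exists (e / 2); first by rewrite divr_gt0.
move=> x' Xx' xx' [w Kw wx']; have [i +] := he w Kw.
rewrite -[x i](subrK (x' i)) commDr wx' addr0.
by have := nrm_comm_ball (x i - x' i) (KX _ Kw); have := xx' i; lra.
Qed.

(** * Baire category in the unit ball *)

Let nrm_lim (w : nat -> A) x y r :
  (forall e, 0 < e -> exists n, forall i, (n <= i)%N -> N (w i - x) < e) ->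
  (exists m, forall i, (m <= i)%N -> N (w i - y) <= r) -> N (x - y) <= r.
Proof.
move=> wx [m wy]; apply/ler_addgt0Pr => e /wx[n wn].
have := wn _ (leq_maxl n m); have := wy _ (leq_maxr n m).
set k := maxn n m.
have := nrm_triangle (w k) x y; rewrite (nrmC x (w k)).
by lra.
Qed.

(** The [F j] are relatively closed, so their boundaries are nowhere dense; the point [h] avoids all
    of these boundaries at once. *)
Lemma ball_baire (F : nat -> set A) :
  (forall j x, X x -> ~ F j x ->
    exists2 e, 0 < e & forall x', X x' -> N (x - x') < e -> ~ F j x') ->
  forall x e, X x -> 0 < e -> exists h, [/\ X h, N (h - x) < e &
    forall j, F j h ->
      exists2 d, 0 < d & forall x', X x' -> N (h - x') < d -> F j x'].
Proof.
move=> Fcl x0 e0 Xx0 e0_gt0.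
pose good (s : A * R) := X s.1 /\ 0 < s.2.
(* A ball is shrunk until it lies in [F j] or misses it. The guard [good s] sits under the
   existential so that [choice] yields a total function. *)
have step j s : exists s' : A * R, good s -> [/\ good s',
    s'.2 <= s.2 / 2, (forall x, N (x - s'.1) <= s'.2 -> N (x - s.1) < s.2) &
    (forall x, X x -> N (x - s'.1) <= s'.2 -> F j x) \/
    (forall x, X x -> N (x - s'.1) <= s'.2 -> ~ F j x)].
  case: s => h r; have [[Xh /= r0]|] := pselect (good (h, r)); last by exists (h, r).
  have [[x [Xx xh nFx]]|nex] :=
      pselect (exists x, [/\ X x, N (x - h) < r & ~ F j x]).
    have [d d0 dF] := Fcl j x Xx nFx.
    pose r' := Num.min (d / 2) (Num.min ((r - N (x - h)) / 2) (r / 2)).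
    have [r'd r'x r'r] : [/\ r' <= d / 2, r' <= (r - N (x - h)) / 2 & r' <= r / 2].
      by rewrite /r' !ge_min !lexx !orbT.
    have r'0 : 0 < r' by rewrite !lt_min !divr_gt0 ?subr_gt0.
    exists (x, r') => _; split=> //=.
      by move=> y yx; have := nrm_triangle x y h; lra.
    by right=> y Xy yx; apply: dF => //; rewrite nrmC; lra.
  exists (h, r / 2) => _; split=> //=.
  - by split=> //=; rewrite divr_gt0.
  - by move=> y; lra.
  - left=> y Xy yh; apply: contrapT => nFy; apply: nex; exists y; split=> //; lra.
have [f fP] := choice (fun js : nat * (A * R) => step js.1 js.2).
pose s := fix s n := if n is n'.+1 then f (n', s n') else (x0, e0 / 2).
have sgood n : good (s n).
  elim: n => [|n ih]; first by split=> //=; rewrite divr_gt0.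
  by have [] := fP (n, s n) ih.
have sS n := fP (n, s n) (sgood n); rewrite -/(s _.+1) /= in sS.
have s_ball n m : (n <= m)%N -> N ((s m).1 - (s n).1) <= (s n).2.
  move=> /subnK <-; move: (m - n)%N => k; elim: k n => [|k ih] n.
    have [_ /ltW] := sgood n.
    by rewrite subrr -(scale0r (0 : A)) (nrmZ hX) normr0 mul0r.
  by rewrite addSnnS; case: (sS n) => _ _ h _; apply/ltW/h/ih.
have s_small n : (s n).2 <= e0 / 2 * 2^-1 ^+ n.
  elim: n => [|n ih]; first by rewrite expr0 mulr1.
  have [_ h _ _] := sS n; apply: (le_trans h).
  by rewrite exprSr mulrA ler_wpM2r.
have s_to0 e : 0 < e -> exists n, (s n).2 < e.
  move=> e_gt0; have e2 : 0 < e / (e0 / 2) by rewrite !divr_gt0.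
  have : (fun n => 2^-1 ^+ n : R) @ \oo --> (0 : R).
    by apply: cvg_expr; rewrite ger0_norm ?invf_lt1 ?ltr1n ?invr_ge0.
  move=> /cvgrPdist_lt /(_ _ e2)[n _ /(_ _ (leqnn n))] /=.
  rewrite sub0r normrN ger0_norm ?exprn_ge0 ?invr_ge0// ltr_pdivlMr ?divr_gt0//.
  by rewrite mulrC => h; exists n; apply: le_lt_trans h.
have [||h Xh sh] := ball_complete hX (w := fun n => (s n).1).
- by move=> n; case: (sgood n).
- move=> e e_gt0; have [n sn] := s_to0 (e / 2) (divr_gt0 e_gt0 (ltr0n R 2)).
  exists n => i j /s_ball si /s_ball sj.
  have := nrm_triangle (s n).1 (s i).1 (s j).1.
  by rewrite (nrmC (s n).1); lra.
have h_ball n : N (h - (s n).1) <= (s n).2.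
  by apply: nrm_lim sh _; exists n => i; apply: s_ball.
exists h; split=> //; first by have /= := h_ball 0%N; lra.
move=> j Fh; have [_ _ sub [inF|notF]] := sS j; last first.
  by case: (notF h Xh (h_ball j.+1)).
(* The next stage puts [h] strictly inside the ball of stage [j.+1], which leaves room for a
   neighborhood. *)
have lt_h : N (h - (s j.+1).1) < (s j.+1).2.
  by have [_ _ + _] := sS j.+1; apply; exact: (h_ball j.+2).
exists ((s j.+1).2 - N (h - (s j.+1).1)); first by rewrite subr_gt0.
move=> x' Xx' hx'; apply: inF => //.
have := nrm_triangle h x' (s j.+1).1; rewrite (nrmC x' h).
by lra.
Qed.

(** * Centralizers of generic elements *)

Variable P : nat -> set A.

(* The [P j] stand for closed balls centered at a countable dense set of L2. *)
Record ball_net : Prop := BallNet {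
  net_convex : forall j, convex_set (P j);
  net_closed : forall j, nrm_closed (P j);
  net_small : forall y e, X y -> 0 < e ->
    exists j, P j y /\ forall y', P j y' -> N (y - y') < e
}.

Hypothesis hP : ball_net.

Definition centralizer (S : set A) : set A :=
  [set y | X y /\ forall s, S s -> comm y s = 0].

Let ball_closed : nrm_closed X.
Proof.
move=> x xX.
have : forall n, exists y, X y /\ N (y - x) < n.+1%:R^-1.
  by move=> n; have [|y Xy yx] := xX n.+1%:R^-1; [rewrite invr_gt0 | exists y].
move=> /choice[w wP].
have wx e : 0 < e -> exists n, forall i, (n <= i)%N -> N (w i - x) < e.
  move=> /invn_lt[n ne]; exists n => i ni.
  by have [_ h] := wP i; apply: (lt_trans h); apply: ne.
have [||z Xz wz] := ball_complete hX (w := w).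
- by move=> n; case: (wP n).
- move=> e e0; have [n ne] := wx (e / 2) (divr_gt0 e0 (ltr0n R 2)).
  exists n => i j /ne wi /ne wj; have := nrm_triangle x (w i) (w j).
  by rewrite (nrmC x); lra.
suff -> : x = z by [].
apply: subr0_eq; apply: (nrm_eq0 hX); apply/eqP.
rewrite eq_le (nrm_ge0 hX) andbT; apply/ler_addgt0Pr => e e0.
rewrite add0r; apply: (nrm_lim wx).
by have [n h] := wz e e0; exists n => i /h /ltW.
Qed.

Let comm_closed s : X s -> nrm_closed [set y | comm y s = 0].
Proof.
move=> Xs y ys; apply: (nrm_eq0 hX); apply/eqP.
rewrite eq_le (nrm_ge0 hX) andbT; apply/ler_addgt0Pr => e e0.
rewrite add0r; have [z zs zy] := ys (e / 2) (divr_gt0 e0 (ltr0n R 2)).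
have -> : comm y s = comm s (z - y).
  by rewrite commBr (commC s z) (zs : comm z s = 0) oppr0 add0r commC.
by have := nrm_comm_ball (z - y) Xs; lra.
Qed.

Let nrm_closedI K K' : nrm_closed K -> nrm_closed K' -> nrm_closed (K `&` K').
Proof.
move=> cK cK' x h; split; [apply: cK | apply: cK'] => e /h[y [? ?] ?];
  by exists y.
Qed.

Let convexI K K' : convex_set K -> convex_set K' -> convex_set (K `&` K').
Proof. by move=> cK cK' a x y [? ?] [? ?] a01; split; [exact: cK|exact: cK']. Qed.

Lemma centralizer_convex S : convex_set (centralizer S).
Proof.
move=> a x y [Xx xS] [Xy yS] a01; split; first exact: (ball_convex hX).
move=> s Ss; rewrite commC commDr !commZr (commC s x) (commC s y) xS// yS//.
by rewrite oppr0 !scaler0 addr0 oppr0.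
Qed.

Lemma centralizer_closed S : S `<=` X -> nrm_closed (centralizer S).
Proof.
move=> SX x h; split.
  by apply: ball_closed => e /h[y [Xy _]]; exists y.
move=> s Ss; apply: (comm_closed (SX _ Ss)) => e /h[y [_ yS]]; exists y => //.
exact: yS.
Qed.

(* At a generic [h] the centralizers vary continuously: some [w] near [y]
   commutes with [(1 - r) h + r h'], and pairing with [k] kills the [h] part. *)
Lemma generic_perturbation S x e : S `<=` X -> X x -> 0 < e ->
  exists h, [/\ X h, N (h - x) < e & forall y k, centralizer S y ->
    comm y h = 0 -> (forall b, centralizer S b -> t (comm h b * k) = 0) ->
    forall h', X h' -> t (comm h' y * k) = 0].
Proof.
move=> SX Xx e0.
(* Membership of [h] in [F j] says that the centralizer of [h] within that of [S] meets [P j]; its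
   persistence under small moves of [h] is the continuity of centralizers. *)
pose F j h := commuting_in (centralizer S `&` P j) (fun _ : unit => h).
have Fcl j z : X z -> ~ F j z ->
    exists2 e, 0 < e & forall z', X z' -> N (z - z') < e -> ~ F j z'.
  move=> Xz nF.
  have [d d0 dF] := @commuting_in_closed unit _ (fun=> z)
    (convexI (@centralizer_convex S) (net_convex hP (j := j)))
    (nrm_closedI (centralizer_closed SX) (net_closed hP (j := j)))
    (fun w => fun wK => (proj1 (proj1 wK))) (fun=> Xz) nF.
  by exists d => // z' Xz' zz'; apply: dF.
have [h [Xh hx hF]] := ball_baire Fcl Xx e0.
exists h; split=> // y k yS yh kS h' Xh'.
apply/eqP; rewrite -normr_le0; apply/ler_addgt0Pr => c c0; rewrite add0r.
(* The trace to be estimated will be at most [2 * N (y - w) * N k]; the added 1 allows [k = 0]. *)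
have k0 : 0 < 2 * (N k + 1) by rewrite mulr_gt0// ltr_wpDl// (nrm_ge0 hX).
have [j [jy jsmall]] := net_small hP yS.1 (divr_gt0 c0 k0).
have [|d d0 hd] := hF j; first by exists y.
(* The bound 1 keeps [hr] in the convex set [X], and [d / 4] suffices because [N (h - h') <= 2]. *)
pose r := Num.min 1 (d / 4).
have r0 : 0 < r by rewrite lt_min ltr01 divr_gt0.
have [r1 rd] : r <= 1 /\ r <= d / 4 by rewrite /r !ge_min !lexx orbT.
pose hr := r *: h' + (1 - r) *: h.
have Xhr : X hr by apply: (ball_convex hX) => //; rewrite ltW.
have hhr : N (h - hr) < d.
  have -> : h - hr = r *: (h - h').
    by rewrite /hr scalerBl scale1r scalerBr opprD opprB addrCA
      [h + _]addrC subrK addrC.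
  rewrite (nrmZ hX) gtr0_norm//.
  have : N (h - h') <= 2.
    have := nrmD hX h (- h'); rewrite nrmN.
    by have := ball_nrm Xh; have := ball_nrm Xh'; lra.
  by have := nrm_ge0 hX (h - h'); nra.
have [w [wS jw] /(_ tt) whr] := hd _ Xhr hhr.
have twh' : t (comm h' w * k) = 0.
  have : t (comm w hr * k) = 0 by rewrite whr mul0r tr0.
  rewrite commDr !commZr (commC w h') (commC w h) mulrDl -!scalerAl (trD hX).
  rewrite !(trZ hX) !mulNr !trN kS// oppr0 mulr0 addr0 mulrN.
  by move=> /eqP; rewrite oppr_eq0 mulf_eq0 gt_eqF// => /eqP.
(* The double adjoint brings the trace to the form [t (st y * x)] of [nrm_CS]. *)
have -> : t (comm h' y * k) = t (st (st (comm h' (y - w))) * k).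
  by rewrite (stK hX) commBr [in RHS]mulrBl trB twh' subr0.
apply: (le_trans (nrm_CS hX _ _)); rewrite nrmS.
have hyw := jsmall _ jw; have := nrm_comm_ball (y - w) Xh'.
have Nk := nrm_ge0 hX k; have NC := nrm_ge0 hX (comm h' (y - w)).
have {}hyw : N (y - w) * (2 * (N k + 1)) <= c by rewrite -ler_pdivlMr// ltW.
by have := nrm_ge0 hX (y - w); nra.
Qed.

Lemma commC_eq0 x y : comm x y = 0 -> comm y x = 0.
Proof. by rewrite commC => /eqP; rewrite oppr_eq0 => /eqP. Qed.

Let comm_st x y : st (comm x y) = comm (st y) (st x).
Proof. by rewrite /comm stB !(stM hX). Qed.

Let tr_comm x y z : t (comm x y * z) = t (x * comm y z).
Proof.
rewrite /comm mulrBl mulrBr !trB -!mulrA; congr (_ - _).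
by rewrite (trC hX) -!mulrA.
Qed.

Let tr_sqr_eq0 x : st x = x -> t (x * x) = 0 -> x = 0.
Proof.
move=> sx txx; apply: (nrm_eq0 hX); apply/eqP; rewrite -sqrf_eq0 (nrmE hX).
by rewrite sx txx.
Qed.

Let tr_ball_eq0 g : st g = g -> (forall h', X h' -> t (h' * g) = 0) -> g = 0.
Proof.
move=> sg h; apply: tr_sqr_eq0 => //.
have [r r0 /h] := ball_absorb hX sg; rewrite -scalerAl (trZ hX) => /eqP.
by rewrite mulf_eq0 gt_eqF// => /eqP.
Qed.

(** Here [S] is empty and the pairing is with [J * k]. Without [J] nothing would follow: the real
    trace of a self-adjoint element times the skew-adjoint [[y, k]] is always 0, whereas [J *
    [y, k]] is self-adjoint. *)
Lemma dense_abelian x e : X x -> 0 < e -> exists h, [/\ X h, N (h - x) < e &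
  forall y k, X y -> X k -> comm y h = 0 -> comm k h = 0 -> comm y k = 0].
Proof.
move=> Xx e0.
have [h [Xh hx hP']] := generic_perturbation (@sub0set _ X) Xx e0.
exists h; split=> // y k Xy Xk yh kh; have [J [JJ sJ JC]] := imag_unit hX.
have commJ a b : comm a (J * b) = J * comm a b.
  by rewrite /comm mulrBr !mulrA (JC a).
have : J * comm y k = 0.
  apply: tr_ball_eq0.
    rewrite (stM hX) comm_st sJ (ball_sa hX Xy) (ball_sa hX Xk) commC.
    by rewrite mulrN mulNr opprK JC.
  move=> h' Xh'; rewrite -commJ -tr_comm; apply: hP' => //.
  move=> b _; rewrite commC mulNr trN tr_comm commJ (commC_eq0 kh) mulr0.
  by rewrite mulr0 tr0 oppr0.
move=> /(congr1 (fun a => J * a)); rewrite mulrA JJ mulr0 mulN1r => /eqP.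
by rewrite oppr_eq0 => /eqP.
Qed.

(* [k = [y, m]] is admissible in [generic_perturbation], because [y] commutes
   with [[h2, b]]; hence [[y, [y, m]] = 0] and so [[y, m] = 0]. *)
Lemma dense_irreducible_pair x1 x2 e : X x1 -> X x2 -> 0 < e ->
  exists h1 h2, [/\ X h1, X h2, N (h1 - x1) < e, N (h2 - x2) < e &
    forall y, X y -> comm y h1 = 0 -> comm y h2 = 0 -> exists a, y = a *: 1].
Proof.
move=> Xx1 Xx2 e0; have [h1 [Xh1 hx1 h1P]] := dense_abelian Xx1 e0.
have sub : [set h1] `<=` X by move=> _ ->.
have [h2 [Xh2 hx2 h2P]] := generic_perturbation sub Xx2 e0.
exists h1, h2; split=> // y Xy yh1 yh2.
have yS : centralizer [set h1] y by split=> // _ ->.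
apply: (ball_center hX) => // m Xm; apply: comm_eq0.
have sy := ball_sa hX Xy; have sm := ball_sa hX Xm.
have yym : comm y (comm y m) = 0.
  apply: tr_ball_eq0.
    by rewrite !comm_st sy sm commC (commC m) -(scaleN1r (comm y m))
      commZr scaleN1r opprK.
  move=> h' Xh'; rewrite -tr_comm; apply: h2P => // b [Xb bh1].
  (* Both [y] and [b] lie in the abelian centralizer of [h1]. *)
  have yb : comm y b = 0 by apply: h1P => //; exact: bh1.
  rewrite -tr_comm.
  suff -> : comm (comm h2 b) y = 0 by rewrite mul0r tr0.
  have [yh yb'] := (comm_eq0 yh2, comm_eq0 yb).
  by rewrite /comm mulrBl mulrBr !mulrA yh yb' -(mulrA h2 y) yb' -(mulrA b y)
       yh !mulrA subrr.
(* The squared norm of [[y, m]] is the trace of [[m, y] * [y, m]], that is, of [m * [y, [y, m]]]. *)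
apply: (nrm_eq0 hX); apply/eqP; rewrite -sqrf_eq0 (nrmE hX) comm_st sy sm.
by rewrite tr_comm yym mulr0 tr0.
Qed.

(** * Irreducibility as countably many open conditions *)

Definition only_scalars_commute (I : Type) (x : I -> A) :=
  forall y, X y -> (forall i, comm y (x i) = 0) -> exists a, y = a *: 1.

Definition net_condition (I : Type) j (x : I -> A) :=
  commuting_in (X `&` P j) x -> exists a, P j (a *: 1).

(** A scalar [a] in a net set of radius [e] around [y] satisfies [|t y - a| <= N (y - a) < e]; then
    [y] would be within [2 * e] of its trace, against the choice of [e]. *)
Lemma only_scalars_commuteP (I : Type) (x : I -> A) :
  only_scalars_commute x <-> forall j, net_condition j x.
Proof.
split=> [xirr j [w [Xw jw] wx]|xnet y Xy yx].
  by have [a wa] := xirr w Xw wx; exists a; rewrite -wa.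
apply: contrapT => ynscal.
pose e := N (y - t y *: 1) / 2.
have e0 : 0 < e.
  rewrite divr_gt0// lt_neqAle (nrm_ge0 hX) andbT; apply/eqP => /esym.
  by move=> /(nrm_eq0 hX)/subr0_eq h; apply: ynscal; exists (t y).
have [j [jy jsmall]] := net_small hP Xy e0.
have [|a /jsmall ya] := xnet j; first by exists y.
have : `|t (y - a *: 1)| <= N (y - a *: 1).
  by have := nrm_CS hX (y - a *: 1) 1; rewrite st1 mul1r nrm1 mulr1.
rewrite trB (trZ hX) (tr1 hX) mulr1 => tya.
have : N (a *: 1 - t y *: 1) <= N (y - a *: 1).
  by rewrite -scalerBl (nrmZ hX) nrm1 mulr1 distrC.
by have := nrm_triangle (a *: 1) y (t y *: 1); rewrite /e in ya; lra.
Qed.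

(** The condition holds trivially once [P j] contains a scalar; otherwise it denies commutation,
    which is stable by [commuting_in_closed]. *)
Lemma net_condition_open (I : Type) j (x : I -> A) :
  (forall i, X (x i)) -> net_condition j x ->
  exists2 e, 0 < e & forall x' : I -> A, (forall i, X (x' i)) ->
    (forall i, N (x i - x' i) < e) -> net_condition j x'.
Proof.
move=> Xx xj; have [jscal|njscal] := pselect (exists a, P j (a *: 1)).
  by exists 1 => // x' _ _ _.
have [|e e0 he] := @commuting_in_closed I _ x
    (convexI (ball_convex hX) (net_convex hP (j := j)))
    (nrm_closedI ball_closed (net_closed hP (j := j))) (@subIsetl _ _ _) Xx.
  by move=> /xj.
by exists e => // x' Xx' xx' /(he _ Xx' xx').
Qed.

End tracial_algebra.

(** * Hilbert spaces as real inner product spaces *)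

Section real_structure.
Context {R : realType} {H : hilbertType R}.
Implicit Types (u v w : H) (a : R).

(** Norms and inner products take values in [R[i]]; their real parts allow ordered-field reasoning
    over [R]. *)
Definition rn u : R := complex.Re `|u|.
Definition rdot u v : R := complex.Re (hdot u v).

Lemma rnE u : `|u| = (rn u)%:C.
Proof. by rewrite RRe_real// normr_real. Qed.

Lemma ReD (x y : R[i]) : complex.Re (x + y) = complex.Re x + complex.Re y.
Proof. by case: x; case: y. Qed.

Lemma ReN (x : R[i]) : complex.Re (- x) = - complex.Re x.
Proof. by case: x. Qed.

Lemma ReZ a (x : R[i]) : complex.Re (a%:C * x) = a * complex.Re x.
Proof. by case: x => b c /=; rewrite mul0r subr0. Qed.

Lemma Re_gt0 (x : R[i]) : 0 < x -> 0 < complex.Re x.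
Proof. by rewrite ltcE => /andP[]. Qed.

Lemma rn_ge0 u : 0 <= rn u.
Proof. by rewrite -ler0c -rnE normr_ge0. Qed.

Lemma rn_eq0 u : rn u = 0 -> u = 0.
Proof. by move=> u0; apply/eqP; rewrite -normr_eq0 rnE u0. Qed.

Lemma rnD u v : rn (u + v) <= rn u + rn v.
Proof. by rewrite -lecR rmorphD /= -!rnE ler_normD. Qed.

Lemma rnZ a u : rn (a%:C *: u) = `|a| * rn u.
Proof.
apply: (@complexI R); rewrite rmorphM /= -!rnE normrZ; congr (_ * _).
by rewrite normc_def /= expr0n addr0 sqrtr_sqr.
Qed.

Lemma rnZc (a : R[i]) u : rn (a *: u) = complex.Re `|a| * rn u.
Proof.
apply: (@complexI R); rewrite rmorphM /= -!rnE normrZ; congr (_ * _).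

Qed.

Lemma rn0 : rn 0 = 0.
Proof. by rewrite /rn normr0. Qed.

Lemma rnN u : rn (- u) = rn u.
Proof. by rewrite /rn normrN. Qed.

Lemma rnC u v : rn (u - v) = rn (v - u).
Proof. by rewrite -rnN opprB. Qed.

Lemma rn_triangle w u v : rn (u - v) <= rn (u - w) + rn (w - v).
Proof. by have := rnD (u - w) (w - v); rewrite subrKA. Qed.

Lemma rdotC u v : rdot u v = rdot v u.
Proof.
rewrite /rdot hermC /= expr0 mul1r.
by case: (hdot v u).
Qed.

Lemma hdotDl u v w : hdot (u + v) w = hdot u w + hdot v w.
Proof. exact: linearDl. Qed.

Lemma hdotDr u v w : hdot w (u + v) = hdot w u + hdot w v.
Proof. exact: linearDr. Qed.

Lemma hdotZl (c : R[i]) u w : hdot (c *: u) w = c * hdot u w.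
Proof. exact: linearZl_LR. Qed.

Lemma hdotZr (c : R[i]) u w : hdot w (c *: u) = c^*%C * hdot w u.
Proof. exact: linearZr_LR. Qed.

Lemma rdotDl u v w : rdot (u + v) w = rdot u w + rdot v w.
Proof. by rewrite /rdot linearDl ReD. Qed.

Lemma rdotNl u w : rdot (- u) w = - rdot u w.
Proof. by rewrite /rdot linearNl ReN. Qed.

Lemma rdotBl u v w : rdot (u - v) w = rdot u w - rdot v w.
Proof. by rewrite rdotDl rdotNl. Qed.

Lemma rdotZl a u w : rdot (a%:C *: u) w = a * rdot u w.
Proof. by rewrite /rdot linearZl_LR /= ReZ. Qed.

Lemma rdotDr u v w : rdot w (u + v) = rdot w u + rdot w v.
Proof. by rewrite !(rdotC w) rdotDl. Qed.

Lemma rdotNr u w : rdot w (- u) = - rdot w u.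
Proof. by rewrite !(rdotC w) rdotNl. Qed.

Lemma rdotBr u v w : rdot w (u - v) = rdot w u - rdot w v.
Proof. by rewrite !(rdotC w) rdotBl. Qed.

Lemma rdotZr a u w : rdot w (a%:C *: u) = a * rdot w u.
Proof. by rewrite !(rdotC w) rdotZl. Qed.

Lemma rdot0l w : rdot 0 w = 0.
Proof. by rewrite /rdot linear0l. Qed.

Lemma rdotii u : rdot u u = rn u ^+ 2.
Proof. by rewrite /rdot -hdotE rnE -rmorphXn. Qed.

Lemma rdot_imag u v : rdot ('i *: u) v = - complex.Im (hdot u v).
Proof. by rewrite /rdot linearZl_LR /=; case: (hdot u v) => b c /=; ring. Qed.

(** Stated for any semidefinite form so that it also applies to [rdot (x u) v] with [x] positive;
    the argument is the discriminant of [q]. *)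
Lemma psd_CS (f : H -> H -> R) :
  (forall u v w, f (u + v) w = f u w + f v w) ->
  (forall a u w, f (a%:C *: u) w = a * f u w) ->
  (forall u v, f u v = f v u) -> (forall u, 0 <= f u u) ->
  forall u v, f u v ^+ 2 <= f u u * f v v.
Proof.
move=> fD fZ fC f0 u v.
have q s : 0 <= f u u + 2 * s * f u v + s ^+ 2 * f v v.
  have := f0 (u + s%:C *: v).
  rewrite fD fZ fC fD fZ [f v (_ + _)]fC fD fZ (fC v u); lra.
have [vv0|vvN0] := eqVneq (f v v) 0; last first.
  have vv : 0 < f v v by rewrite lt_neqAle eq_sym vvN0 f0.
  have := q (- (f u v / f v v)).
  suff -> : f u u + 2 * - (f u v / f v v) * f u v + (- (f u v / f v v)) ^+ 2 * f v v
     = f u u - f u v ^+ 2 / f v v by rewrite subr_ge0 ler_pdivrMr.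
  by field.
have [->|uvN0] := eqVneq (f u v) 0; first by rewrite expr0n mulr_ge0.
(* For [f v v = 0] the polynomial is affine in [s], and at this [s] its value is -1. *)
have := q (- (f u u + 1) / (2 * f u v)).
rewrite vv0 mulr0 addr0.
have -> : f u u + 2 * (- (f u u + 1) / (2 * f u v)) * f u v = -1 by field.
by rewrite ler0N1.
Qed.

Lemma rdot_CS u v : `|rdot u v| <= rn u * rn v.
Proof.
rewrite -(@ler_pXn2r _ 2) ?nnegrE ?mulr_ge0 ?rn_ge0// real_normK ?num_real//.
rewrite exprMn -!rdotii; apply: psd_CS => *.
- exact: rdotDl.
- exact: rdotZl.
- exact: rdotC.
- by rewrite rdotii sqr_ge0.
Qed.

Lemma rdot_le u v : rdot u v <= rn u * rn v.
Proof. exact: le_trans (ler_norm _) (rdot_CS _ _). Qed.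

Lemma rdot_ext u v : (forall w, rdot u w = rdot v w) -> u = v.
Proof.
move=> uv; apply: subr0_eq; apply: rn_eq0.
by apply/eqP; rewrite -sqrf_eq0 -rdotii rdotBl uv subrr.
Qed.

(** * Limits of sequences of vectors *)

Definition seqlim (w : nat -> H) l :=
  forall e, 0 < e -> exists n, forall i, (n <= i)%N -> rn (w i - l) < e.

Lemma seqlim_complete (w : nat -> H) :
  (forall e, 0 < e -> exists n, forall i j, (n <= i)%N -> (n <= j)%N ->
    rn (w i - w j) < e) -> exists l, seqlim w l.
Proof.
move=> wC.
have /cauchy_cvg wl : cauchy (w @ \oo).
  apply: cauchy_exP => e e0; have [n wn] := wC _ (Re_gt0 e0).
  exists (w n); exists n => // i /= ni; rewrite -ball_normE /= rnE.
  by rewrite -(RRe_real (gtr0_real e0)) ltcR; apply: wn.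
exists (lim (w @ \oo)) => e e0; move/cvgrPdist_lt: wl => /(_ e%:C).
rewrite ltcR => /(_ e0)[n _ wn]; exists n => i ni.
by rewrite rnC -ltcR -rnE; apply: wn.
Qed.

Lemma geometric_tail (w : nat -> H) C q : 0 <= C -> 0 <= q -> q < 1 ->
  (forall k, rn (w k.+1 - w k) <= C * q ^+ k) ->
  forall i j, (j <= i)%N -> rn (w i - w j) <= C / (1 - q) * q ^+ j.
Proof.
move=> C0 q0 q1 wq i j /subnK <-; move: (i - j)%N => k.
have q1' : 0 < 1 - q by rewrite subr_gt0.
(* The factor [1 - q ^+ k] turns the bound into the exact finite geometric sum, which makes the
   induction go through. *)
suff : rn (w (k + j)%N - w j) <= C / (1 - q) * q ^+ j * (1 - q ^+ k).
  move=> h; apply: (le_trans h); rewrite ler_piMr ?lerBlDr ?lerDl ?exprn_ge0//.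
  by rewrite !mulr_ge0 ?invr_ge0 ?exprn_ge0// ltW.
elim: k => [|k ih]; first by rewrite add0n subrr rn0 expr0 subrr mulr0.
apply: (le_trans (rn_triangle (w (k + j)%N) _ _)); rewrite addSn.
have := wq (k + j)%N; rewrite exprD exprS.
have -> : C * (q ^+ k * q ^+ j) = C / (1 - q) * q ^+ j * (q ^+ k * (1 - q)).
  by field; rewrite gt_eqF.
by move: ih; set D := C / _ * _; lra.
Qed.

Lemma geometric_to0 (C q e : R) : 0 <= q -> q < 1 -> 0 < e ->
  exists n, forall k, (n <= k)%N -> C * q ^+ k < e.
Proof.
move=> q0 q1 e0; have : geometric C q @ \oo --> (0 : R).
  by apply: cvg_geometric; rewrite ger0_norm.
move=> /cvgrPdist_lt /(_ _ e0)[n _ nq]; exists n => k /nq /=.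
by rewrite sub0r normrN; apply: le_lt_trans; apply: ler_norm.
Qed.

Lemma geometric_cvg (w : nat -> H) C q : 0 <= C -> 0 <= q -> q < 1 ->
  (forall k, rn (w k.+1 - w k) <= C * q ^+ k) -> exists l, seqlim w l.
Proof.
move=> C0 q0 q1 wq; apply: seqlim_complete => e e0.
have [n nq] := geometric_to0 (C / (1 - q)) q0 q1 (divr_gt0 e0 (ltr0n R 2)).
exists n => i j ni nj; have := rn_triangle (w n) (w i) (w j).
rewrite (rnC (w n)); have := nq n (leqnn n).
have := geometric_tail C0 q0 q1 wq ni; have := geometric_tail C0 q0 q1 wq nj.
by lra.
Qed.

Lemma seqlim_uniq (w : nat -> H) l l' : seqlim w l -> seqlim w l' -> l = l'.
Proof.
move=> wl wl'; apply: subr0_eq; apply: rn_eq0; apply/eqP.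
rewrite eq_le rn_ge0 andbT; apply/ler_addgt0Pr => e e0; rewrite add0r.
have [n wn] := wl _ (divr_gt0 e0 (ltr0n R 2)).
have [m wm] := wl' _ (divr_gt0 e0 (ltr0n R 2)).
have := wn _ (leq_maxl n m); have := wm _ (leq_maxr n m).
have := rn_triangle (w (maxn n m)) l l'; rewrite (rnC l (w _)).
by lra.
Qed.

Lemma seqlimD (w w' : nat -> H) l l' :
  seqlim w l -> seqlim w' l' -> seqlim (fun n => w n + w' n) (l + l').
Proof.
move=> wl wl' e e0.
have [n wn] := wl _ (divr_gt0 e0 (ltr0n R 2)).
have [m wm] := wl' _ (divr_gt0 e0 (ltr0n R 2)).
exists (maxn n m) => i; rewrite geq_max => /andP[/wn h /wm h'].
by rewrite opprD addrACA; have := rnD (w i - l) (w' i - l'); lra.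
Qed.

Lemma seqlim_map (f : H -> H) (w : nat -> H) l :
  (exists C, forall u v, rn (f u - f v) <= C * rn (u - v)) ->
  seqlim w l -> seqlim (fun n => f (w n)) (f l).
Proof.
move=> [C fC] wl e e0.
have C1 : 0 < `|C| + 1 by rewrite ltr_wpDl.
have [n wn] := wl _ (divr_gt0 e0 C1).
exists n => i /wn; rewrite ltr_pdivlMr//; apply: le_lt_trans.
apply: (le_trans (fC _ _)); rewrite mulrC ler_wpM2l ?rn_ge0//.
by rewrite (le_trans (ler_norm C))// lerDl.
Qed.

Lemma seqlim_rdot_le (w : nat -> H) l v c : seqlim w l ->
  (exists m, forall i, (m <= i)%N -> rdot (w i) v <= c) -> rdot l v <= c.
Proof.
move=> wl [m wc]; apply/ler_addgt0Pr => e e0.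
have v1 : 0 < rn v + 1 by rewrite ltr_wpDl ?rn_ge0.
have [n wn] := wl _ (divr_gt0 e0 v1).
have := wc _ (leq_maxr n m); have := wn _ (leq_maxl n m).
set k := maxn n m; rewrite ltr_pdivlMr// => kl wk.
have -> : rdot l v = rdot (l - w k) v + rdot (w k) v by rewrite rdotBl subrK.
have := rdot_le (l - w k) v; rewrite rnC; have := rn_ge0 (w k - l); have := rn_ge0 v.
by nra.
Qed.

Lemma seqlim_rn_le (w : nat -> H) l v c : seqlim w l ->
  (exists m, forall i, (m <= i)%N -> rn (w i - v) <= c) -> rn (l - v) <= c.
Proof.
move=> wl [m wc]; apply/ler_addgt0Pr => e /wl[n wn].
have := wn _ (leq_maxl n m); have := wc _ (leq_maxr n m).
have := rn_triangle (w (maxn n m)) l v; rewrite (rnC l (w _)).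
by lra.
Qed.

Lemma seqlim_rdot_ge (w : nat -> H) l v c : seqlim w l ->
  (exists m, forall i, (m <= i)%N -> c <= rdot (w i) v) -> c <= rdot l v.
Proof.
move=> wl [m wc]; rewrite -lerN2 -rdotNr; apply: (seqlim_rdot_le wl).
by exists m => i mi; rewrite rdotNr lerN2; apply: wc.
Qed.

(** Passes the symmetry of operators to a strong limit, each side having its moving vector in the
    first slot. *)
Lemma seqlim_rdot_eq2 (w w' : nat -> H) l l' v v' :
  seqlim w l -> seqlim w' l' -> (forall i, rdot (w i) v = rdot (w' i) v') ->
  rdot l v = rdot l' v'.
Proof.
move=> wl wl' ww'; apply/eqP; rewrite -subr_eq0 -normr_le0.
apply/ler_addgt0Pr => e e0; rewrite add0r.
have v1 : 0 < 2 * (rn v + 1) by rewrite mulr_gt0// ltr_wpDl ?rn_ge0.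
have v'1 : 0 < 2 * (rn v' + 1) by rewrite mulr_gt0// ltr_wpDl ?rn_ge0.
have [n wn] := wl _ (divr_gt0 e0 v1); have [m wm] := wl' _ (divr_gt0 e0 v'1).
have := wn _ (leq_maxl n m); have := wm _ (leq_maxr n m); set k := maxn n m.
rewrite !ltr_pdivlMr// => h' h.
have -> : rdot l v - rdot l' v' = rdot (l - w k) v - rdot (l' - w' k) v'.
  by rewrite !rdotBl ww'; lra.
have := rdot_CS (l - w k) v; have := rdot_CS (l' - w' k) v'; rewrite (rnC l) (rnC l').
have := ler_normB (rdot (l - w k) v) (rdot (l' - w' k) v').
have aux (p r : R) : 0 <= p -> p * (2 * (r + 1)) < e -> p * r <= e / 2 by lra.
by have := aux _ _ (rn_ge0 _) h; have := aux _ _ (rn_ge0 _) h'; lra.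
Qed.

Lemma seqlimZ (k : R[i]) (w : nat -> H) l :
  seqlim w l -> seqlim (fun n => k *: w n) (k *: l).
Proof.
apply: seqlim_map; exists (complex.Re `|k|) => u v.
by rewrite -scalerBr rnZc.
Qed.

(** * Symmetric and positive operators *)

Definition sym_op (x : H -> H) :=
  linear x /\ forall u v, rdot (x u) v = rdot u (x v).

Definition psd (x : H -> H) := sym_op x /\ forall u, 0 <= rdot (x u) u.

Section linear_facts.
Variable x : H -> H.
Hypothesis xlin : linear x.

Lemma linfD u v : x (u + v) = x u + x v.
Proof. by have := xlin 1 u v; rewrite !scale1r. Qed.

Lemma linf0 : x 0 = 0.
Proof. by have := xlin (-1) 0 0; rewrite !scaleN1r !addNr. Qed.

Lemma linfZ (c : R[i]) u : x (c *: u) = c *: x u.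
Proof. by have := xlin c u 0; rewrite !addr0 linf0 addr0. Qed.

Lemma linfN u : x (- u) = - x u.
Proof. by rewrite -scaleN1r linfZ scaleN1r. Qed.

Lemma linfB u v : x (u - v) = x u - x v.
Proof. by rewrite linfD linfN. Qed.

Lemma bounded_opP : bounded_op x <->
  exists C, forall u, rn (x u) <= C * rn u.
Proof.
split=> [[_ xc]|[C xC]].
  have : \forall v \near (0 : H), `|x 0 - x v| < 1%:C.
    by have /cvgrPdist_lt := xc 0; apply; rewrite ltcR.
  move=> /nbhs_normP[d /= d0 dx].
  have {dx} dx v : rn v < complex.Re d -> rn (x v) <= 1.
    move=> vd; have := dx v; rewrite /ball_ /= linf0 !sub0r !normrN !rnE.
    rewrite -(RRe_real (gtr0_real d0)) !ltcR => h; apply/ltW/h/vd.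
  have {d0} d0 : 0 < complex.Re d := Re_gt0 d0.
  exists (2 / complex.Re d) => u.
  have [->|u0] := eqVneq u 0; first by rewrite linf0 rn0 mulr0.
  have ru : 0 < rn u.
    by rewrite lt_neqAle rn_ge0 andbT eq_sym; apply: contra_neq u0; apply: rn_eq0.
  (* Scaling [u] by [a] gives norm [e / 2], inside the ball on which [x] is bounded by 1. *)
  set e := complex.Re d in dx d0 *; pose a := e / (2 * rn u).
  have a0 : 0 < a by rewrite divr_gt0// mulr_gt0.
  have := dx (a%:C *: u); rewrite linfZ !rnZ gtr0_norm//.
  have -> : a * rn u = e / 2 by rewrite /a; field; rewrite gt_eqF.
  rewrite ltr_pdivrMr// ltr_pMr// ltr1n => /(_ isT); rewrite mulrC -ler_pdivlMr//.
  move=> h; apply: (le_trans h); rewrite /a div1r invfM invrK.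
  by rewrite le_eqVlt; apply/orP; left; apply/eqP; ring.
split=> // u; apply/cvgrPdist_lt => e e0.
have e0' := Re_gt0 e0; have C1 : 0 < `|C| + 1 by rewrite ltr_wpDl.
near=> v.
rewrite -linfB rnE -(RRe_real (gtr0_real e0)) ltcR.
have : rn (u - v) < complex.Re e / (`|C| + 1).
  rewrite -ltcR -rnE; near: v; apply: cvgr_dist_lt; first exact: cvg_id.
  by rewrite ltcR divr_gt0.
rewrite ltr_pdivlMr//; apply: le_lt_trans; apply: (le_trans (xC _)).
by rewrite mulrC ler_wpM2l ?rn_ge0// (le_trans (ler_norm C))// lerDl.
Unshelve. all: by end_near.
Qed.

End linear_facts.

(** Real symmetry applied to ['i *: u] yields the imaginary parts. *)
Lemma sym_adjoint x : sym_op x -> is_adjoint x x.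
Proof.
move=> [xlin xs] u v; apply/eqP; rewrite eq_complex; apply/andP; split.
  by apply/eqP; apply: xs.
have := xs ('i *: u) v; rewrite (linfZ xlin) !rdot_imag => /oppr_inj ->.
exact: eqxx.
Qed.

(** Cauchy-Schwarz for the form [rdot (x u) v] at [v = x u], followed by division by
    [rn (x u) ^+ 2]: this is [x^2 <= C x] without square roots. *)
Lemma psd_norm_le x (C : R) u : psd x -> (forall v, rdot (x v) v <= C * rn v ^+ 2) ->
  rn (x u) ^+ 2 <= C * rdot (x u) u.
Proof.
move=> [[xlin xs] x0] xC.
have : (rn (x u) ^+ 2) ^+ 2 <= rdot (x u) u * (C * rn (x u) ^+ 2).
  apply: le_trans (ler_wpM2l (x0 u) (xC (x u))); rewrite -rdotii.
  have h := @psd_CS (fun v w => rdot (x v) w); apply: (h _ _ _ x0 u (x u)) => *.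
  - by rewrite (linfD xlin) rdotDl.
  - by rewrite (linfZ xlin) rdotZl.
  - by rewrite xs rdotC.
have [->|xu0] := eqVneq (x u) 0; first by rewrite rn0 rdot0l mulr0 expr0n.
have ru : 0 < rn (x u) ^+ 2.
  rewrite exprn_gt0// lt_neqAle rn_ge0 andbT eq_sym.
  by apply: contra_neq xu0; apply: rn_eq0.
by rewrite mulrA -[leLHS]/(_ * _) ler_pM2r// mulrC.
Qed.

Lemma contraction_psd_le x u : psd x -> (forall v, rdot (x v) v <= rn v ^+ 2) ->
  rn (x u) <= rn u.
Proof.
move=> xp x1; rewrite -(@ler_pXn2r _ 2) ?nnegrE ?rn_ge0//.
have := @psd_norm_le x 1 u xp; rewrite !mul1r => h.
by apply: le_trans (x1 u); apply: h => v; rewrite mul1r.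
Qed.

End real_structure.

(** * Resolvents and monotone limits of positive operators *)

Section resolvents.
Context {R : realType} {H : hilbertType R}.
Implicit Types (u v : H) (b c : H -> H).

(** The operator [c] is the inverse of [1 + b]; a right inverse suffices because [1 + b] is
    injective for positive [b]. *)
Definition resolvent b c := psd c /\ forall u, b (c u) + c u = u.

Lemma resolvent_uniq b u v : psd b -> b u + u = b v + v -> u = v.
Proof.
move=> [[blin _] b0] uv; apply: subr0_eq; apply: rn_eq0; apply/eqP.
rewrite -sqrf_eq0 eq_le sqr_ge0 andbT -rdotii.
have : b (u - v) + (u - v) = 0 by rewrite (linfB blin) addrACA uv -opprD subrr.
move=> /(congr1 (fun z => rdot z (u - v))); rewrite rdotDl rdot0l => h.
by have := b0 (u - v); lra.
Qed.

(** A solution of [b l + l = u] is a fixed point of [l |-> (u + (C - b) l) / (1 + C)], a contraction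
    of ratio [C / (1 + C)] because [0 <= C - b <= C]. *)
Lemma resolvent_exists b (C : R) : psd b ->
  (forall u, rdot (b u) u <= C * rn u ^+ 2) -> exists c, resolvent b c.
Proof.
move=> bpsd bC'; have [[blin bs] b0] := bpsd.
wlog C0 : C bC' / 0 <= C.
  move=> h; apply: (h `|C|) => // u.
  by apply: (le_trans (bC' u)); rewrite ler_wpM2r ?sqr_ge0// ler_norm.
pose e v := C%:C *: v - b v.
have elin : linear e.
  move=> a u v; rewrite /e blin scalerDr !scalerA [C%:C * a]mulrC -scalerA.
  by rewrite scalerBr opprD addrACA.
have epsd : psd e.
  split; first split=> //.
    by move=> u v; rewrite /e rdotBl rdotBr rdotZl rdotZr bs.
  by move=> u; rewrite /e rdotBl rdotZl rdotii subr_ge0.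
have eC v : rn (e v) <= C * rn v.
  rewrite -(@ler_pXn2r _ 2) ?nnegrE ?mulr_ge0 ?rn_ge0// exprMn expr2.
  have ef z : rdot (e z) z <= C * rn z ^+ 2.
    by rewrite /e rdotBl rdotZl rdotii lerBlDr lerDl.
  apply: (le_trans (psd_norm_le v epsd ef)); rewrite expr2 -mulrA.
  by rewrite ler_wpM2l// -expr2.
pose k := (1 + C)^-1; pose q := k * C.
have C1 : 0 < 1 + C by rewrite ltr_wpDr.
have k0 : 0 < k by rewrite invr_gt0.
have q0 : 0 <= q by rewrite mulr_ge0// ltW.
have q1 : q < 1 by rewrite /q mulrC ltr_pdivrMr// mul1r ltrDr.
have exl u : exists l, b l + l = u.
  pose f v := k%:C *: (u + e v).
  have fq v v' : rn (f v - f v') <= q * rn (v - v').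
    rewrite /f -scalerBr opprD addrACA subrr add0r -(linfB elin) rnZ.
    by rewrite gtr0_norm// -mulrA ler_wpM2l// ltW.
  pose w n := iter n f 0.
  have wq n : rn (w n.+1 - w n) <= rn (w 1%N) * q ^+ n.
    elim: n => [|n ih]; first by rewrite subr0 expr0 mulr1.
    apply: (le_trans (fq _ _)); rewrite exprS mulrCA ler_wpM2l//.
  have [l wl] := geometric_cvg (rn_ge0 _) q0 q1 wq.
  exists l; have fl : f l = l.
    apply: (@seqlim_uniq _ _ (fun n => w n.+1)).
      by apply: (@seqlim_map _ _ f w) => //; exists q.
    by move=> d /wl[n wn]; exists n => i ni; apply: wn; rewrite ltnW.
  have := congr1 (fun z => (1 + C)%:C *: z) fl.
  rewrite /f scalerA -rmorphM /= mulfV ?gt_eqF// scale1r rmorphD /= scalerDl.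
  rewrite scale1r /e => h; apply: (addIr (C%:C *: l - b l)); rewrite h.
  by rewrite addrC addrA subrK addrC.
have [c cP] := choice exl.
have clin : linear c.
  move=> a u v; apply: (resolvent_uniq bpsd).
  by rewrite cP blin addrACA -scalerDr !cP.
have csym u v : rdot (c u) v = rdot u (c v).
  by rewrite -{1}(cP v) -{2}(cP u) rdotDr rdotDl bs.
exists c; split=> //; split=> // u.
by rewrite -{2}(cP u) rdotDr rdotii addr_ge0 ?sqr_ge0// rdotC.
Qed.

Lemma resolvent_comm b c y u : psd b -> resolvent b c -> linear y ->
  (forall v, b (y v) = y (b v)) -> c (y u) = y (c u).
Proof.
move=> bp [_ cP] ylin yb; apply: (resolvent_uniq bp).
by rewrite cP yb -(linfD ylin) cP.
Qed.

Section resolvent_forms.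
Variables b c : H -> H.
Hypotheses (bp : psd b) (bc : resolvent b c).

Lemma resolvent_form u : rdot (c u) u = rdot (b (c u)) (c u) + rn (c u) ^+ 2.
Proof. by rewrite -{2}(bc.2 u) rdotDr rdotii (rdotC (c u)). Qed.

Lemma resolvent_le1 u : rdot (c u) u <= rn u ^+ 2.
Proof.
have h := rdot_le (c u) u; have := resolvent_form u.
have := bp.2 (c u); have := rn_ge0 (c u); have := rn_ge0 u; nra.
Qed.

(* [c = (1 + b)^-1] is the supremum over [v] of these quadratic expressions. *)
Lemma resolvent_ge_var u v :
  2 * rdot u v - rdot (b v) v - rn v ^+ 2 <= rdot (c u) u.
Proof.
have [[blin bs] b0] := bp; have [_ cP] := bc.
have hb : rdot (b v) (c u) = rdot (b (c u)) v by rewrite bs rdotC.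
have hu : rdot u v = rdot (b (c u)) v + rdot (c u) v by rewrite -{1}(cP u) rdotDl.
have hn : rn (c u - v) ^+ 2 = rn (c u) ^+ 2 - 2 * rdot (c u) v + rn v ^+ 2.
  by rewrite -!rdotii rdotBl !rdotBr (rdotC v (c u)); lra.
have := sqr_ge0 (rn (c u - v)); have := b0 (c u - v).
by rewrite hn (linfB blin) rdotBl !rdotBr hb resolvent_form hu; lra.
Qed.

Lemma resolvent_ge u : rn u ^+ 2 - rdot (b u) u <= rdot (c u) u.
Proof. by have := resolvent_ge_var u u; rewrite rdotii; lra. Qed.

(** With [s = rdot (c (d u)) (d u)], symmetry of [d] gives [s <= rn (d (c (d u))) * rn u], while
    [m * rn (d (c (d u))) ^+ 2 <= s] by [resolvent_form]; hence [m * s ^+ 2 <= s * rn u ^+ 2]. *)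
Lemma resolvent_absorb d (m : R) u : sym_op d -> 0 < m ->
  (forall v, m * rn (d v) ^+ 2 <= rdot (b v) v) ->
  rdot (c (d u)) (d u) <= rn u ^+ 2 / m.
Proof.
move=> [_ ds] m0 db; rewrite ler_pdivlMr//.
have h := resolvent_form (d u); set s := rdot _ _ in h *.
have dw := db (c (d u)); have sle : s <= rn (d (c (d u))) * rn u.
  by rewrite /s -ds rdot_le.
have := sqr_ge0 (rn (c (d u))); move: dw sle.
have := rn_ge0 (d (c (d u))); have := rn_ge0 u.
set x := rn u; set y := rn (d _); set z := rdot (b _) _ in h *.
set p := rn _ ^+ 2 in h * => x0 y0 yz sxy p0.
have my : m * y ^+ 2 <= s by lra.
have [s0|s0] := leP s 0; first by have := sqr_ge0 x; nra.
have : s * (s * m) <= s * x ^+ 2.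
  have : s ^+ 2 * m <= (y * x) ^+ 2 * m.
    apply: ler_wpM2r; first exact: ltW.
    by rewrite ler_pXn2r ?nnegrE ?mulr_ge0// ltW.
  have := ler_wpM2r (sqr_ge0 x) my; lra.
by rewrite ler_pM2l.
Qed.

End resolvent_forms.

(** The variational bound for [c] is tested at [c' u], the point where the one for [c'] is
    attained. *)
Lemma resolvent_anti b b' c c' u : psd b -> psd b' -> resolvent b c ->
  resolvent b' c' -> (forall v, rdot (b v) v <= rdot (b' v) v) ->
  rdot (c' u) u <= rdot (c u) u.
Proof.
move=> bp b'p bc b'c' bb'; have := resolvent_ge_var bp bc u (c' u).
by have := resolvent_form b'c' u; have := bb' (c' u); rewrite (rdotC u); lra.
Qed.

(** The forms decrease and are bounded below, and [psd_norm_le] with [C = 1] converts differences of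
    forms into squared distances of vectors; thus every sequence [a n u] is Cauchy. *)
Lemma decreasing_limit (a : nat -> H -> H) : (forall n, psd (a n)) ->
  (forall u, rdot (a 0%N u) u <= rn u ^+ 2) ->
  (forall n u, rdot (a n.+1 u) u <= rdot (a n u) u) ->
  exists l, [/\ psd l, (forall u, seqlim (fun n => a n u) (l u)) &
    forall n u, rdot (l u) u <= rdot (a n u) u].
Proof.
move=> ap a1 adec.
have amono m n u : (m <= n)%N -> rdot (a n u) u <= rdot (a m u) u.
  move=> /subnK <-; elim: (n - m)%N => [//|k ih].
  by rewrite addSn; apply: le_trans ih.
have dist m n u : (m <= n)%N ->
    rn (a m u - a n u) ^+ 2 <= rdot (a m u) u - rdot (a n u) u.
  move=> mn; have [[ml ms] m0] := ap m; have [[nl ns] n0] := ap n.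
  have ep : psd (fun v => a m v - a n v).
    split; first split.
    - by move=> k v w; rewrite ml nl scalerBr opprD addrACA.
    - by move=> v w; rewrite rdotBl rdotBr ms ns.
    - by move=> v; rewrite rdotBl subr_ge0 amono.
  have := @psd_norm_le _ _ _ 1 u ep; rewrite mul1r rdotBl; apply => v.
  rewrite rdotBl mul1r lerBlDr (le_trans (amono _ _ v (leq0n m)))//.
  by rewrite (le_trans (a1 v))// lerDl.
have lim u : exists l, seqlim (fun n => a n u) l.
  apply: seqlim_complete => e e0.
  pose S : set R := range (fun n => rdot (a n u) u).
  have Sinf : has_inf S.
    split; first by exists (rdot (a 0%N u) u), 0%N.
    by exists 0 => _ [n _ <-]; case: (ap n).
  have e20 : 0 < (e / 2) ^+ 2 by rewrite exprn_gt0// divr_gt0.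
  have [_ [n _ <-] nS] := inf_adherent e20 Sinf.
  have small i : (n <= i)%N -> rn (a n u - a i u) < e / 2.
    move=> ni; suff : rn (a n u - a i u) ^+ 2 < (e / 2) ^+ 2.
      by rewrite ltr_pXn2r ?nnegrE ?rn_ge0// ltW// divr_gt0.
    have := dist n i u ni.
    have : inf S <= rdot (a i u) u by apply: ge_inf; [case: Sinf | exists i].
    lra.
  exists n => i j /small ni /small nj.
  by have := rn_triangle (a n u) (a i u) (a j u); rewrite (rnC _ (a n u)); lra.
have [l lP] := choice lim.
have lle n u : rdot (l u) u <= rdot (a n u) u.
  by apply: (seqlim_rdot_le (lP u)); exists n => i; apply: amono.
exists l; split=> //; split; first split.
- move=> k u v; apply: (seqlim_uniq (lP _)).
  have -> : (fun n => a n (k *: u + v)) = fun n => k *: a n u + a n v.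
    by apply: funext => n; rewrite (ap n).1.1.
  exact: seqlimD (seqlimZ _ (lP u)) (lP v).
- move=> u v; rewrite [RHS]rdotC; apply: seqlim_rdot_eq2 (lP u) (lP v) _ => n.
  by rewrite (ap n).1.2 rdotC.
- move=> u; apply: (seqlim_rdot_ge (lP u)); exists 0%N => i _.
  by case: (ap i).
Qed.

End resolvents.

(** * Von Neumann algebras *)

Section von_neumann.
Context {R : realType} {H : hilbertType R}.
Implicit Types (x y z : H -> H) (u v w : H).

Lemma commutant_linear (S : set (H -> H)) x : commutant S x -> linear x.
Proof. by case=> -[]. Qed.

Lemma commutant_id (S : set (H -> H)) : commutant S id.
Proof.
split; last by [].
by apply/bounded_opP => //; exists 1 => u; rewrite mul1r.
Qed.

Lemma commutantD (S : set (H -> H)) x y : (forall s, S s -> linear s) ->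
  commutant S x -> commutant S y -> commutant S (x + y).
Proof.
move=> Slin [[xl xc] xS] [[yl yc] yS]; split; last first.
  move=> s Ss; apply: funext => u; rewrite /= !fctE /= (linfD (Slin _ Ss)).
  by have := congr1 (@^~ u) (xS s Ss); have := congr1 (@^~ u) (yS s Ss) => /= -> ->.
have [C xC] := (bounded_opP xl).1 (conj xl xc).
have [D yD] := (bounded_opP yl).1 (conj yl yc).
have xyl : linear (x + y).
  by move=> a u v; rewrite !fctE xl yl scalerDr addrACA.
apply/bounded_opP => //; exists (C + D) => u; rewrite !fctE mulrDl.
by apply: le_trans (rnD _ _) _; apply: lerD.
Qed.

Lemma commutantZ (S : set (H -> H)) (a : R[i]) x : (forall s, S s -> linear s) ->
  commutant S x -> commutant S (a *: x).
Proof.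
move=> Slin [[xl xc] xS]; split; last first.
  move=> s Ss; apply: funext => u; rewrite /= !fctE /= (linfZ (Slin _ Ss)).
  by have := congr1 (@^~ u) (xS s Ss) => /= ->.
have [C xC] := (bounded_opP xl).1 (conj xl xc).
have axl : linear (a *: x).
  by move=> b u v; rewrite !fctE xl scalerDr !scalerA mulrC.
apply/bounded_opP => //; exists (complex.Re `|a| * C) => u.
by rewrite !fctE rnZc -mulrA ler_wpM2l// -ler0c RRe_real ?normr_real.
Qed.

Lemma commutant_comp (S : set (H -> H)) x y :
  commutant S x -> commutant S y -> commutant S (x \o y).
Proof.
move=> [[xl xc] xS] [[yl yc] yS]; split; last first.
  move=> s Ss; apply: funext => u /=.
  have := congr1 (@^~ (y u)) (xS s Ss); have := congr1 (@^~ u) (yS s Ss) => /=.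
  by move=> -> ->.
split; first by move=> a u v; rewrite /= yl xl.
by move=> u; apply: continuous_comp; [exact: yc | exact: xc].
Qed.

Lemma adjoint_uniq x y z : is_adjoint x y -> is_adjoint x z -> y = z.
Proof.
move=> xy xz; apply: funext => v; apply: rdot_ext => u.
by rewrite !(rdotC _ u) /rdot -xy xz.
Qed.

Lemma adj_eq x y : is_adjoint x y -> adj x = y.
Proof.
move=> xy; apply: adjoint_uniq (xy).
exact: (@xgetPex _ (fun=> 0) [set y | is_adjoint x y] (ex_intro _ y xy)).
Qed.

Lemma hdotC u v : hdot u v = (hdot v u)^*%C.
Proof. by rewrite hermC /= expr0 mul1r. Qed.

Lemma adjoint_sym x y : is_adjoint x y -> is_adjoint y x.
Proof. by move=> xy u v; rewrite hdotC -xy -hdotC. Qed.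

Lemma sym_opP x : linear x -> is_adjoint x x <-> sym_op x.
Proof.
move=> xl; split=> [xx|]; last exact: sym_adjoint.
by split=> // u v; rewrite /rdot xx.
Qed.

Variable M : set (H -> H).
Hypothesis hM : von_neumann_algebra M.

Lemma vna_linear x : M x -> linear x.
Proof. by rewrite -hM.2; apply: commutant_linear. Qed.

Lemma vna_bound x : M x -> exists C, forall u, rn (x u) <= C * rn u.
Proof.
move=> Mx; apply: (bounded_opP (vna_linear Mx)).1.
by move: Mx; rewrite -hM.2 => -[].
Qed.

Let commutant_vna_linear s : commutant M s -> linear s.
Proof. exact: commutant_linear. Qed.

Lemma vna_id : M id.
Proof. by rewrite -hM.2; apply: commutant_id. Qed.

Lemma vnaD x y : M x -> M y -> M (x + y).
Proof. by rewrite -hM.2; apply: commutantD. Qed.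

Lemma vnaZ (a : R[i]) x : M x -> M (a *: x).
Proof. by rewrite -hM.2; apply: commutantZ. Qed.

Lemma vnaN x : M x -> M (- x).
Proof. by rewrite -scaleN1r; apply: vnaZ. Qed.

Lemma vnaB x y : M x -> M y -> M (x - y).
Proof. by move=> Mx My; apply: vnaD => //; apply: vnaN. Qed.

Lemma vna_comp x y : M x -> M y -> M (x \o y).
Proof. by rewrite -hM.2; apply: commutant_comp. Qed.

Lemma vna0 : M 0.
Proof. by rewrite -(scale0r (id : H -> H)); apply/vnaZ/vna_id. Qed.

(** Membership through the bicommutant: this is how resolvents and strong limits are placed in
    [M]. *)
Lemma vna_intro x (C : R) : linear x -> (forall u, rn (x u) <= C * rn u) ->
  (forall y, commutant M y -> forall u, x (y u) = y (x u)) -> M x.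
Proof.
move=> xl xC xM; rewrite -hM.2; split; first by apply/bounded_opP => //; exists C.
by move=> y My; apply: funext => u; apply: xM.
Qed.

Lemma vna_commute x y u : M x -> commutant M y -> x (y u) = y (x u).
Proof. by move=> Mx [_ /(_ x Mx)/(congr1 (@^~ u))]. Qed.

Lemma vna_adj x : M x -> is_adjoint x (adj x) /\ M (adj x).
Proof. by move=> /hM.1[y xy My]; rewrite (adj_eq xy). Qed.

Lemma adjD x y : M x -> M y -> adj (x + y) = adj x + adj y.
Proof.
move=> /vna_adj[hx _] /vna_adj[hy _]; apply: adj_eq => u v.
by rewrite !fctE hdotDl hdotDr hx hy.
Qed.

Lemma adj_scale (a : R) x : M x -> adj (a%:C *: x) = a%:C *: adj x.
Proof.
move=> /vna_adj[hx _]; apply: adj_eq => u v.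
by rewrite !fctE hdotZl hdotZr hx conjc_real.
Qed.

Lemma adj_comp x y : M x -> M y -> adj (x \o y) = adj y \o adj x.
Proof.
move=> /vna_adj[hx _] /vna_adj[hy _]; apply: adj_eq => u v.
by rewrite /= hx hy.
Qed.

Lemma adjK x : M x -> adj (adj x) = x.
Proof. by move=> /vna_adj[hx _]; apply/adj_eq/adjoint_sym. Qed.

Lemma adj_id : adj (id : H -> H) = id.
Proof. exact: adj_eq. Qed.

Lemma sa_partP x : sa_part M x <-> M x /\ sym_op x.
Proof.
split=> -[Mx xx]; split=> //.
  by apply/(sym_opP (vna_linear Mx)); rewrite {2}xx; apply: (vna_adj Mx).1.
by rewrite (adj_eq (sym_adjoint xx)).
Qed.

Lemma opnorm_le1 x : M x -> opnorm x <= 1 <-> forall u, rn (x u) <= rn u.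
Proof.
move=> Mx; have xl := vna_linear Mx; have [C xC] := vna_bound Mx.
pose S := [set complex.Re `|x u| | u in [set u | `|u| <= 1]].
have S0 : S !=set0 by exists (rn (x 0)), 0 => //=; rewrite normr0.
have inS u : `|u| <= 1 -> rn (x u) <= opnorm x.
  move=> u1; apply: ub_le_sup; last by exists u.
  exists `|C| => _ [v v1 <-]; apply: (le_trans (xC v)).
  move: v1; rewrite /= rnE lecR => v1.
  apply: (le_trans (ler_wpM2r (rn_ge0 v) (ler_norm C))).
  by rewrite ler_piMr.
split=> [x1 u|x1].
  have [->|u0] := eqVneq u 0; first by rewrite (linf0 xl).
  have ru : 0 < rn u.
    by rewrite lt_neqAle rn_ge0 andbT eq_sym; apply: contra_neq u0; apply: rn_eq0.
  have := inS ((rn u)^-1%:C *: u); rewrite rnE (linfZ xl) !rnZ.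
  rewrite gtr0_norm ?invr_gt0// mulVf ?gt_eqF// => /(_ (lexx _)) h.
  by have := le_trans h x1; rewrite mulrC ler_pdivrMr// mul1r.
apply: sup_le_ub => // _ [u u1 <-]; apply: (le_trans (x1 u)).
by move: u1; rewrite /= rnE lecR.
Qed.

Lemma sa_ballP x : sa_ball M x <->
  [/\ M x, sym_op x & forall u, rn (x u) <= rn u].
Proof.
split=> [[/sa_partP[Mx xs] /opnorm_le1 x1]|[Mx xs x1]].
  by split=> //; apply: x1.
by split; [exact/sa_partP | exact/opnorm_le1].
Qed.

Lemma op_leP x y : sym_op x -> sym_op y ->
  op_le x y <-> forall u, rdot (x u) u <= rdot (y u) u.
Proof.
move=> xs ys; split=> h u.
  have := h u; rewrite lecE => /andP[_].
  by rewrite -[complex.Re (hdot _ _)]/(rdot _ _) rdotBl subr_ge0.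
have [[xl xx] [yl yy]] := (xs, ys).
have zs : sym_op (fun v => y v - x v).
  split; first by move=> a v w; rewrite xl yl scalerBr opprD addrACA.
  by move=> v w; rewrite rdotBl rdotBr xx yy.
rewrite lecE; apply/andP; split; last first.
  by rewrite -[complex.Re (hdot _ _)]/(rdot _ _) rdotBl subr_ge0.
(* The order of [R[i]] also demands a vanishing imaginary part; symmetry makes the value equal to
   its conjugate. *)
have := sym_adjoint zs u u; rewrite /= [RHS]hdotC.
by case: (hdot _ _) => a b [] /=; rewrite eq_sym => ?; apply/eqP; lra.
Qed.

End von_neumann.

(** * Normal states *)

Section trace.
Context {R : realType} {H : hilbertType R}.
Variables (M : set (H -> H)) (tau : (H -> H) -> R[i]).
Hypotheses (hM : von_neumann_algebra M) (tau_state : state M tau).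
Hypotheses (tau_normal : normal M tau) (tau_faithful : faithful M tau).
Variables (L2 : hilbertType R) (L : (H -> H) -> L2).
Hypothesis hL : is_L2 M tau L.
Implicit Types (x y : H -> H) (u v : H).

Definition rtr x : R := complex.Re (tau x).

Lemma gnsD x y : M x -> M y -> L (x + y) = L x + L y.
Proof. by case: hL => LP _ _ Mx My; rewrite -[x]scale1r LP // scale1r scale1r. Qed.

Lemma gns0 : L 0 = 0.
Proof.
have M0 := vna0 hM; have := gnsD M0 M0.
by rewrite addr0 -{1}[L 0]addr0 => /addrI.
Qed.

Lemma gnsZ (a : R[i]) x : M x -> L (a *: x) = a *: L x.
Proof.
case: hL => LP _ _ Mx; have := LP a x 0 Mx (vna0 hM).
by rewrite gns0 !addr0.
Qed.

Lemma gnsB x y : M x -> M y -> L (x - y) = L x - L y.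
Proof.
move=> Mx My; rewrite gnsD//; last exact: vnaN.
have -> : - y = (-1 : R[i]) *: y by rewrite scaleN1r.
by rewrite gnsZ// scaleN1r.
Qed.

Lemma gns_rdot x y : M x -> M y -> rdot (L x) (L y) = rtr (adj y \o x).
Proof. by case: hL => _ LP _ Mx My; rewrite /rdot LP. Qed.

Lemma gns_sqr x : M x -> rn (L x) ^+ 2 = rtr (adj x \o x).
Proof. by move=> Mx; rewrite -rdotii gns_rdot. Qed.

Lemma norm2E x : M x -> norm2 tau x = rn (L x).
Proof.
move=> Mx; rewrite /norm2 -[complex.Re _]/(rtr _) -gns_sqr//.
by rewrite sqrtr_sqr ger0_norm ?rn_ge0.
Qed.

Lemma gns_eq0 x : M x -> L x = 0 -> x = 0.
Proof.
move=> Mx Lx; apply: tau_faithful => //.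
by case: hL => _ <- // _; rewrite Lx; apply: linear0l.
Qed.

Lemma rtrE x : M x -> rtr x = rdot (L x) (L id).
Proof. by move=> Mx; rewrite gns_rdot ?adj_id //; exact: vna_id. Qed.

Lemma rtrD x y : M x -> M y -> rtr (x + y) = rtr x + rtr y.
Proof. by move=> Mx My; rewrite !rtrE ?gnsD ?rdotDl//; exact: vnaD. Qed.

Lemma rtrZ (a : R) x : M x -> rtr (a%:C *: x) = a * rtr x.
Proof. by move=> Mx; rewrite !rtrE ?gnsZ ?rdotZl//; exact: vnaZ. Qed.

Lemma rtr_id : rtr id = 1.
Proof. by case: tau_state => _ _; rewrite /rtr => ->. Qed.

Lemma rtr_adj x : M x -> rtr (adj x) = rtr x.
Proof.
move=> Mx; have [_ Ma] := vna_adj hM Mx.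
by rewrite (rtrE Ma) rdotC (gns_rdot (vna_id hM) Ma) (adjK hM Mx).
Qed.

(* Apply normality to the directed set [{x, y}]: this spares square roots. *)
Lemma rtr_mono x y : M x -> M y -> sym_op x -> sym_op y ->
  (forall u, rdot (x u) u <= rdot (y u) u) -> rtr x <= rtr y.
Proof.
move=> Mx My xs ys xy.
have sax : sa_part M x by apply/(sa_partP hM).
have say : sa_part M y by apply/(sa_partP hM).
have lexy : op_le x y by apply/op_leP.
have leyy : op_le y y by apply/op_leP.
have xysup : supremums (tau @` [set x; y]) (tau y).
  apply: tau_normal; first by move=> _ [] ->.
    split; first by exists x; left.
    move=> a b ha hb; exists y; split; first by right.
      by case: ha => ->.
    by case: hb => ->.
  by split=> // [d [->|->]//|z saz zd]; apply: zd; right.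
have : tau x <= tau y by apply: xysup.1; exists x => //; left.
by rewrite lecE => /andP[].
Qed.

(** As forms, [adj x \o x <= C ^+ 2], and the trace preserves this by [rtr_mono]. *)
Lemma gns_bound x (C : R) : M x -> 0 <= C ->
  (forall u, rn (x u) <= C * rn u) -> rn (L x) <= C.
Proof.
move=> Mx C0 xC; have [xx Max] := vna_adj hM Mx.
rewrite -(@ler_pXn2r _ 2) ?nnegrE ?rn_ge0// gns_sqr//.
have MC : M ((C ^+ 2)%:C *: id) by apply/(vnaZ hM)/(vna_id hM).
have Mxx : M (adj x \o x) by apply: (vna_comp hM).
have -> : C ^+ 2 = rtr ((C ^+ 2)%:C *: id).
  by rewrite rtrZ ?rtr_id ?mulr1//; exact: vna_id.
have xxE u v : rdot (adj x (x u)) v = rdot (x u) (x v).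
  by rewrite rdotC (rdotC (x u)) /rdot -xx.
apply: rtr_mono => //.
- split; first exact: vna_linear Mxx.
  by move=> u v /=; rewrite xxE rdotC -xxE rdotC.
- split; first exact: vna_linear MC.
  by move=> u v; rewrite !fctE rdotZl rdotZr.
- move=> u; rewrite !fctE /= xxE rdotZl !rdotii -exprMn ler_pXn2r ?nnegrE ?rn_ge0//.
  by rewrite mulr_ge0 ?rn_ge0.
Qed.

(** Normality is applied to the increasing family [id - a n], whose supremum is [id - l]. *)
Lemma rtr_decreasing_lim (a : nat -> H -> H) l (e : R) :
  (forall n, M (a n)) -> (forall n, psd (a n)) -> M l -> psd l ->
  (forall n u, rdot (a n.+1 u) u <= rdot (a n u) u) ->
  (forall u, seqlim (fun n => a n u) (l u)) ->
  (forall n u, rdot (l u) u <= rdot (a n u) u) ->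
  (forall n, rtr (id - a n) <= e) -> rtr (id - l) <= e.
Proof.
move=> Ma ap Ml lp adec al la ae.
pose D := range (fun n => (id : H -> H) - a n).
have Mid := vna_id hM.
have sid x : sym_op x -> sym_op (id - x).
  move=> [xl xs]; split.
    by move=> k u v; rewrite !fctE /= xl scalerBr opprD addrACA.
  by move=> u v; rewrite !fctE /= rdotBl rdotBr xs.
have Dsa n : sa_part M (id - a n).
  by apply/(sa_partP hM); split; [exact: vnaB | apply: sid; case: (ap n)].
have amono m n u : (m <= n)%N -> rdot (a n u) u <= rdot (a m u) u.
  move=> /subnK <-; elim: (n - m)%N => [//|k ih].
  by rewrite addSn; apply: le_trans ih.
have le_id x y : sym_op x -> sym_op y -> (forall u, rdot (y u) u <= rdot (x u) u) ->
    op_le (id - x) (id - y).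
  move=> xs ys h; apply/(op_leP (sid _ xs) (sid _ ys)) => u.
  by rewrite !fctE /= !rdotBl lerD2l lerN2.
have lsup : supremums (tau @` D) (tau (id - l)).
apply: tau_normal; first by move=> _ [n _ <-].
- split; first by exists (id - a 0%N), 0%N.
  move=> _ _ [m _ <-] [n _ <-]; exists (id - a (maxn m n)); split.
  + by exists (maxn m n).
  + by apply: le_id => [||u]; [case: (ap m)|case: (ap (maxn m n))|
       exact/amono/leq_maxl].
  + by apply: le_id => [||u]; [case: (ap n)|case: (ap (maxn m n))|
       exact/amono/leq_maxr].
- split.
  + by apply/(sa_partP hM); split; [exact: vnaB | apply: sid; case: lp].
  + by move=> _ [n _ <-]; apply: le_id => //; [case: (ap n) | case: lp].
  + move=> y /(sa_partP hM)[My ys] yub.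
    apply/(op_leP (sid _ lp.1) ys) => u; rewrite !fctE /= rdotBl lerBlDl -lerBlDr.
    apply: (seqlim_rdot_ge (al u)); exists 0%N => n _.
    have : op_le (id - a n) y by apply: yub; exists n.
    move=> /(op_leP (sid _ (ap n).1) ys) /(_ u); rewrite !fctE /= rdotBl.
    lra.
(* Elements of [R[i]] compare only when their imaginary parts agree, so the traces must be known to
   be real before [e%:C] can serve as an upper bound. *)
have real x : M x -> sym_op x -> complex.Im (tau x) = 0.
  move=> Mx [xl xs]; have := sym_adjoint (conj xl xs) => xx.
  have Lid : tau x = hdot (L x) (L id).
    by case: hL => _ -> //; rewrite adj_id.
  have : hdot (L id) (L x) = tau x.
    by case: hL => _ -> //; rewrite (adj_eq xx).
  rewrite hdotC -Lid; case: (tau x) => p q [] /=; lra.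
have Il : complex.Im (tau (id - l)) = 0.
  by apply: real; [exact: vnaB | apply: sid; case: lp].
have : tau (id - l) <= e%:C.
  apply: (lsup.2 e%:C) => _ [_ [n _ <-] <-]; rewrite lecE /= ae andbT eq_sym.
  by have [MD sD] := (sa_partP hM _).1 (Dsa n); apply/eqP; apply: real.
by rewrite lecE => /andP[].
Qed.

Lemma vna_seqlim (a : nat -> H -> H) l (C : R) : (forall n, M (a n)) ->
  linear l -> (forall u, rn (l u) <= C * rn u) ->
  (forall u, seqlim (fun n => a n u) (l u)) -> M l.
Proof.
move=> Ma ll lC al; apply: (vna_intro hM ll lC) => y cy u.
apply: (seqlim_uniq (al (y u))).
have -> : (fun n => a n (y u)) = fun n => y (a n u).
  by apply: funext => n; rewrite (vna_commute _ (Ma n) cy).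
have yl : linear y by exact: commutant_linear cy.
have [D yD] : exists D : R, forall v, rn (y v) <= D * rn v.
  by apply/bounded_opP => //; case: cy.
apply: (@seqlim_map _ _ y) (al u); exists D => v w.
by rewrite -(linfB yl).
Qed.

End trace.

(** * Completeness of the unit ball in the 2-norm *)

Section completeness.
Context {R : realType} {H : hilbertType R}.
Variables (M : set (H -> H)) (tau : (H -> H) -> R[i]).
Hypotheses (hM : von_neumann_algebra M) (tau_state : state M tau).
Hypotheses (tau_normal : normal M tau) (tau_faithful : faithful M tau).
Variables (L2 : hilbertType R) (L : (H -> H) -> L2).
Hypothesis hL : is_L2 M tau L.
Implicit Types (u v : H).

Let tr := rtr tau.

Section fast_sequence.
Variable x : nat -> H -> H.
Hypotheses (Mx : forall n, M (x n)) (xs : forall n, sym_op (x n)).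
Hypothesis x1 : forall n u, rn (x n u) <= rn u.
Hypothesis xfast : forall k, rn (L (x k.+1) - L (x k)) <= 4^-1 ^+ k.+1.

Let d k : H -> H := x k.+1 - x k.

Let Md k : M (d k).
Proof. by apply: vnaB. Qed.

Let dE k u : d k u = x k.+1 u - x k u.
Proof. by []. Qed.

Let ds k : sym_op (d k).
Proof.
split; first exact: (vna_linear hM (Md k)).
by move=> u v; rewrite !dE rdotBl rdotBr !(xs _).2.
Qed.

Let Mid : M id := vna_id hM.

(** Since [||d m||_2^2 <= 16^-(m+1)], the weights [4 ^+ m] keep the trace of the sum at most 1,
    while growing fast enough to make the damped differences summable. *)
Fixpoint wsum n : H -> H :=
  if n is m.+1 then wsum m + (4 ^+ m)%:C *: (d m \o d m) else 0.

Let wsum0 u : wsum 0 u = 0.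
Proof. by []. Qed.

Let wsumS n u : wsum n.+1 u = wsum n u + (4 ^+ n)%:C *: d n (d n u).
Proof. by []. Qed.

Let Mdd n : M (d n \o d n).
Proof. exact: vna_comp. Qed.

Let Mwsum n : M (wsum n).
Proof.
elim: n => [|n ih]; first exact: vna0.
by apply: vnaD => //; apply: vnaZ.
Qed.

Let wsum_form n u :
  rdot (wsum n.+1 u) u = rdot (wsum n u) u + 4 ^+ n * rn (d n u) ^+ 2.
Proof. by rewrite wsumS rdotDl rdotZl (ds n).2 rdotii. Qed.

Let wsum_psd n : psd (wsum n).
Proof.
have wl := vna_linear hM (Mwsum n); split; first (split=> //; move: wl => _).
  elim: n => [|n ih] u v; first by rewrite !wsum0 rdot0l rdotC rdot0l.
  by rewrite !wsumS rdotDl rdotDr rdotZl rdotZr ih !(ds n).2.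
move: wl => _; elim: n => [|n ih] u; first by rewrite wsum0 rdot0l.
by rewrite wsum_form addr_ge0// mulr_ge0 ?sqr_ge0// exprn_ge0.
Qed.

Let wsum_ge n k u : (k < n)%N -> 4 ^+ k * rn (d k u) ^+ 2 <= rdot (wsum n u) u.
Proof.
elim: n => [//|n ih]; rewrite ltnS leq_eqVlt wsum_form => /predU1P[->|/ih h].
  by rewrite lerDr; case: (wsum_psd n).
by rewrite (le_trans h)// lerDl mulr_ge0 ?sqr_ge0// exprn_ge0.
Qed.

Let wsum_bound n : exists C : R, forall u, rdot (wsum n u) u <= C * rn u ^+ 2.
Proof.
have [C wC] := vna_bound hM (Mwsum n); exists C => u.
apply: (le_trans (rdot_le _ _)); rewrite expr2 mulrA.
by rewrite ler_wpM2r ?rn_ge0.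
Qed.

Let rtr_dd k : tr (d k \o d k) = rn (L (d k)) ^+ 2.
Proof.
by rewrite (gns_sqr hL (Md k)) (adj_eq (sym_adjoint (ds k))).
Qed.

Let rtr_wsum n : tr (wsum n) <= 1.
Proof.
(* The gap [2^-1 ^+ n] absorbs the next term, which is at most [p ^+ 2 / 16] for [p = 2^-1 ^+ n]. *)
suff : tr (wsum n) <= 1 - 2^-1 ^+ n.
  move=> h; apply: (le_trans h); rewrite lerBlDr lerDl exprn_ge0//.
elim: n => [|n ih].
  by rewrite expr0 subrr /tr (rtrE hM hL (vna0 hM)) (gns0 hM hL) rdot0l.
rewrite /tr -[wsum n.+1]/(wsum n + (4 ^+ n)%:C *: (d n \o d n)).
rewrite (rtrD hM hL)//; last exact: vnaZ.
rewrite (rtrZ hM hL)// -/tr rtr_dd.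
pose p : R := 2^-1 ^+ n.
have p0 : 0 < p by rewrite exprn_gt0.
have p1 : p <= 1 by rewrite exprn_ile1// invf_le1// ler1n.
have e4 : 4^-1 ^+ n = p ^+ 2.
  by rewrite /p -exprM mulnC exprM; congr (_ ^+ _); field.
have h : rn (L (d n)) ^+ 2 <= (p ^+ 2 / 4) ^+ 2.
  rewrite ler_pXn2r ?nnegrE ?rn_ge0 ?divr_ge0 ?sqr_ge0//.
  by rewrite -e4 mulrC -exprS /d (gnsB hM hL).
have -> : (4 : R) ^+ n = p ^- 2 by rewrite -e4 exprVn invrK.
have {}h : p ^- 2 * rn (L (d n)) ^+ 2 <= p ^+ 2 / 16.
  rewrite mulrC ler_pdivrMr ?exprn_gt0//; apply: (le_trans h).
  by rewrite le_eqVlt; apply/orP; left; apply/eqP; field.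
have pp : p ^+ 2 <= p by rewrite expr2 ler_piMr// ltW.
move: ih; rewrite (exprS _ n) -/p -/tr.
by move: h; set w := p ^- 2 * _; lra.
Qed.

Let mu K : R := K.+1%:R^-1.

Let mu0 K : 0 < mu K.
Proof. by rewrite invr_gt0. Qed.

Let wK K n : H -> H := (mu K ^+ 2)%:C *: wsum n.

Let wK_form K n u : rdot (wK K n u) u = mu K ^+ 2 * rdot (wsum n u) u.
Proof. by rewrite /wK fctE rdotZl. Qed.

Let wK_psd K n : psd (wK K n).
Proof.
have [[wl ws] w0] := wsum_psd n; split; last first.
  by move=> u; rewrite wK_form mulr_ge0 ?sqr_ge0.
split; first exact: (vna_linear hM (vnaZ hM _ (Mwsum n))).
by move=> u v; rewrite /wK !fctE rdotZl rdotZr ws.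
Qed.

Let res_ex : exists c : nat * nat -> H -> H, forall p, resolvent (wK p.1 p.2) (c p).
Proof.
suff ex (p : nat * nat) : exists c, resolvent (wK p.1 p.2) c.
  by have [f fP] := choice ex; exists f.
case: p => K n /=; have [C wC] := wsum_bound n.
apply: (@resolvent_exists _ _ _ (mu K ^+ 2 * C)) => // u.
by rewrite wK_form -mulrA ler_wpM2l// sqr_ge0.
Qed.

Section damping.
(* As [mu K = 1/(K+1)] tends to 0, [c (K, n)] is close to the identity in trace
   uniformly in [n], yet every [d k \o c (K, n)] with [k < n] has norm at most
   [2^-k / mu K]: on the range of the limit the sequence [x] converges. *)
Variable c : nat * nat -> H -> H.
Hypothesis cP : forall p, resolvent (wK p.1 p.2) (c p).

Let c_psd p : psd (c p).
Proof. by case: (cP p). Qed.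

Let c_le1 p u : rdot (c p u) u <= rn u ^+ 2.
Proof. exact: (resolvent_le1 (wK_psd p.1 p.2) (cP p)). Qed.

Let Mc p : M (c p).
Proof.
have [cp _] := cP p.
apply: (vna_intro hM cp.1.1 (C := 1)) => [u|y My u].
  by rewrite mul1r (contraction_psd_le u cp (c_le1 p)).
have yl : linear y := commutant_linear My.
apply: (resolvent_comm u (wK_psd p.1 p.2) (cP p) yl) => v.
by rewrite /wK !fctE (linfZ yl) (vna_commute _ (Mwsum p.2) My).
Qed.

Let c_decr K n u : rdot (c (K, n.+1) u) u <= rdot (c (K, n) u) u.
Proof.
apply: (resolvent_anti _ (wK_psd K n) (wK_psd K n.+1) (cP (K, n)) (cP (K, n.+1))).
move=> v; rewrite !wK_form ler_wpM2l ?sqr_ge0// wsum_form lerDl.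
by rewrite mulr_ge0 ?sqr_ge0// exprn_ge0.
Qed.

Let c_mono K n u : rdot (c (K, n) u) u <= rdot (c (K.+1, n) u) u.
Proof.
apply: (resolvent_anti _ (wK_psd K.+1 n) (wK_psd K n) (cP (K.+1, n)) (cP (K, n))).
move=> v; rewrite !wK_form ler_wpM2r ?(wsum_psd n).2//.
rewrite ler_pXn2r ?nnegrE ?(ltW (mu0 _))// /mu lef_pV2 ?posrE ?ltr0n// ler_nat.
exact: leqnSn.
Qed.

(** By [resolvent_ge], [id - c (K, n) <= wK K n] as forms, and [rtr_wsum] bounds the trace of the
    latter. *)
Let rtr_c K n : tr (id - c (K, n)) <= mu K ^+ 2.
Proof.
have MwK : M (wK K n) by apply: vnaZ.
have : tr (id - c (K, n)) <= tr (wK K n).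
  apply: (rtr_mono hM tau_normal) => //.
  - exact: vnaB.
  - have [cl cs] := (c_psd (K, n)).1; split.
      by move=> a u v; rewrite !fctE /= cl scalerBr opprD addrACA.
    by move=> u v; rewrite !fctE /= rdotBl rdotBr cs.
  - by case: (wK_psd K n).
  - move=> u; rewrite !fctE /= rdotBl rdotii.
    by have := resolvent_ge (wK_psd K n) (cP (K, n)) u; lra.
rewrite {2}/tr (rtrZ hM hL)// => h; apply: (le_trans h).
by rewrite ler_piMr ?sqr_ge0.
Qed.

Section damping_limit.
Variable l : nat -> H -> H.
Hypothesis lP : forall K, [/\ psd (l K),
  (forall u, seqlim (fun n => c (K, n) u) (l K u)) &
  forall n u, rdot (l K u) u <= rdot (c (K, n) u) u].

Let l_le1 K u : rdot (l K u) u <= rn u ^+ 2.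
Proof. by have [_ _ h] := lP K; apply: (le_trans (h 0%N u)). Qed.

Let l_psd K : psd (l K).
Proof. by case: (lP K). Qed.

Let Ml K : M (l K).
Proof.
have [lp lc _] := lP K.
apply: (@vna_seqlim _ _ _ hM (fun n => c (K, n)) _ 1) => //; first by case: lp => -[].
by move=> u; rewrite mul1r (contraction_psd_le u lp (@l_le1 K)).
Qed.

Let rtr_l K : tr (id - l K) <= mu K ^+ 2.
Proof.
have [lp lc lle] := lP K.
exact: (rtr_decreasing_lim hM tau_normal hL (a := fun n => c (K, n)) _ _ _ _
  (@c_decr K) lc lle).
Qed.

Let l_mono K u : rdot (l K u) u <= rdot (l K.+1 u) u.
Proof.
have [_ _ lle] := lP K; have [_ lc _] := lP K.+1.
apply: (seqlim_rdot_ge (lc u)); exists 0%N => n _.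
exact: le_trans (lle n u) (c_mono _ _ _).
Qed.

(** [resolvent_absorb] with [m = mu K ^+ 2 * 4 ^+ k] bounds [l K \o d k]; both factors being
    symmetric, the bound passes to the adjoint [d k \o l K]. *)
Let l_damp K k u : rn (d k (l K u)) <= K.+1%:R * 2^-1 ^+ k * rn u.
Proof.
have [lp lc lle] := lP K.
have e0 : 0 < mu K ^+ 2 * 4 ^+ k by rewrite mulr_gt0 ?exprn_gt0 ?mu0.
have ld v : rn (l K (d k v)) <= K.+1%:R * 2^-1 ^+ k * rn v.
  have : rn (l K (d k v)) ^+ 2 <= rdot (l K (d k v)) (d k v).
    have := @psd_norm_le _ _ _ 1 (d k v) lp; rewrite mul1r; apply=> w.
    by rewrite mul1r.
  (* The sum [wsum k.+1] is the first to contain the term of [d k]. *)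
  have := lle k.+1 (d k v).
  have := resolvent_absorb (cP (K, k.+1)) v (ds k) e0.
  move=> h1 h2 h3.
  have {h1 h2 h3} : rn (l K (d k v)) ^+ 2 <= rn v ^+ 2 / (mu K ^+ 2 * 4 ^+ k).
    apply: (le_trans h3); apply: (le_trans h2); apply: h1 => w.
    by rewrite wK_form -mulrA ler_wpM2l ?sqr_ge0// wsum_ge.
  have -> : rn v ^+ 2 / (mu K ^+ 2 * 4 ^+ k) = (K.+1%:R * 2^-1 ^+ k * rn v) ^+ 2.
    rewrite invfM /mu -exprVn invrK mulrC !exprMn; congr (_ * _ * _).
    by rewrite -exprM mulnC exprM -exprVn; congr (_ ^+ _); field.
  by rewrite ler_pXn2r ?nnegrE ?rn_ge0// !mulr_ge0 ?exprn_ge0 ?rn_ge0.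
have [->|du0] := eqVneq (d k (l K u)) 0.
  by rewrite rn0 !mulr_ge0 ?exprn_ge0 ?rn_ge0.
have ru : 0 < rn (d k (l K u)).
  by rewrite lt_neqAle rn_ge0 andbT eq_sym; apply: contra_neq du0; apply: rn_eq0.
rewrite -(ler_pM2r ru) -expr2 -rdotii (ds k).2 lp.1.2.
apply: (le_trans (rdot_le _ _)); rewrite [leRHS]mulrAC [leRHS]mulrC.
by rewrite ler_wpM2l ?rn_ge0.
Qed.

(** The operators [id - l K] decrease to some [e] in [M] with [||e||_2^2 <= tr e <= mu n ^+ 2] for
    every [n]; faithfulness gives [e = 0]. *)
Let l_to_id u : seqlim (fun K => l K u) u.
Proof.
pose a K : H -> H := id - l K.
have aE K v : a K v = v - l K v by [].
have a_psd K : psd (a K).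
  have [[ll ls] l0] := l_psd K; split; first split.
  - by move=> k v w; rewrite !aE ll scalerBr opprD addrACA.
  - by move=> v w; rewrite !aE rdotBl rdotBr ls.
  - by move=> v; rewrite aE rdotBl rdotii subr_ge0.
have a1 K v : rdot (a K v) v <= rn v ^+ 2.
  by rewrite aE rdotBl rdotii lerBlDr lerDl; case: (l_psd K).
have adec K v : rdot (a K.+1 v) v <= rdot (a K v) v.
  by rewrite !aE !rdotBl lerD2l lerN2.
have [e [ep ae ele]] := decreasing_limit a_psd (a1 0%N) adec.
have Ma K : M (a K) by apply: vnaB.
have e1 v : rdot (e v) v <= rn v ^+ 2 by apply: (le_trans (ele 0%N v)).
have en v : rn (e v) <= 1 * rn v by rewrite mul1r (contraction_psd_le v ep e1).
have Me : M e by apply: (vna_seqlim hM Ma _ en ae); case: ep => -[].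
have e_tr : rn (L e) ^+ 2 <= 0.
  apply/ler_addgt0Pr => r r0; rewrite add0r.
  have [n nr] := invn_lt r0.
  have : rn (L e) ^+ 2 <= tr e.
    rewrite (gns_sqr hL Me) (adj_eq (sym_adjoint ep.1)).
    apply: (rtr_mono hM tau_normal) => //; [exact: vna_comp| |exact: ep.1|].
      split; first exact: (vna_linear hM (vna_comp hM Me Me)).
      by move=> v w; rewrite /= !ep.1.2.
    move=> v; rewrite /= ep.1.2 rdotii.
    by have := @psd_norm_le _ _ _ 1 v ep; rewrite mul1r; apply=> w; rewrite mul1r.
  have : tr e <= tr (a n).
    by apply: (rtr_mono hM tau_normal) => //; [exact: ep.1|case: (a_psd n)].
  have := rtr_l n; have := nr n (leqnn n); rewrite -/(mu n).
  have := mu0 n; have : mu n <= 1 by rewrite /mu invf_le1// ler1n.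
  by rewrite -/(a n); nra.
have e0 : e = 0.
  apply: (gns_eq0 tau_faithful hL Me); apply: rn_eq0; apply/eqP.
  by rewrite -sqrf_eq0 eq_le e_tr sqr_ge0.
move=> r /(ae u)[n nr]; exists n => i /nr.
by rewrite e0 -[(0 : H -> H) u]/(0 : H) subr0 aE rnC.
Qed.

Let dist_damp K i j u : (j <= i)%N ->
  rn (x i (l K u) - x j (l K u)) <= 2 * K.+1%:R * rn u * 2^-1 ^+ j.
Proof.
have q : (2^-1 : R) < 1 by rewrite invf_lt1// ltr1n.
move=> ji.
have := @geometric_tail _ _ (fun n => x n (l K u)) (K.+1%:R * rn u) 2^-1 _ _ q _ i j ji.
have -> : K.+1%:R * rn u / (1 - 2^-1) = 2 * K.+1%:R * rn u by field.
apply=> //; first by rewrite mulr_ge0 ?rn_ge0.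
by move=> k; rewrite -dE mulrAC l_damp.
Qed.

Let x_lin n : linear (x n).
Proof. by case: (xs n). Qed.

(** On the vectors [l K u] the sequence is Cauchy by [dist_damp]; these approximate [u], and the
    contractions [x n] carry the property over to [u]. *)
Let strong_limit : exists z, forall u, seqlim (fun n => x n u) (z u).
Proof.
suff ex u : exists w, seqlim (fun n => x n u) w.
  by have [f fP] := choice ex; exists f.
apply: seqlim_complete => e e0.
have [K Ku] := l_to_id u (divr_gt0 e0 (ltr0n R 8)).
have {Ku} := Ku K (leqnn K); set v := l K u => vu.
have q : (2^-1 : R) < 1 by rewrite invf_lt1// ltr1n.
have q0 : 0 <= (2^-1 : R) by rewrite invr_ge0.
have [n nq] := geometric_to0 (2 * K.+1%:R * rn u) q0 q (divr_gt0 e0 (ltr0n R 4)).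
exists n => i j ni nj.
have small m : (n <= m)%N -> rn (x m u - x n u) < e / 2.
  move=> nm; have := dist_damp K u nm; rewrite -/v => h.
  have := rn_triangle (x m v) (x m u) (x n u); rewrite -(linfB (x_lin m)).
  have := rn_triangle (x n v) (x m v) (x n u); rewrite -(linfB (x_lin n)).
  have := x1 m (u - v); have := x1 n (v - u); have := nq n (leqnn n).
  by rewrite (rnC u v); lra.
have := small i ni; have := small j nj; have := rn_triangle (x n u) (x i u) (x j u).
by rewrite (rnC (x n u)); lra.
Qed.

Lemma fast_ball_limit_aux : exists z, [/\ M z, sym_op z,
  forall u, rn (z u) <= rn u & seqlim (fun n => L (x n)) (L z)].
Proof.
have [z zP] := strong_limit.
have zl : linear z.
  move=> a u v; apply: (seqlim_uniq (zP _)).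
  have -> : (fun n => x n (a *: u + v)) = fun n => a *: x n u + x n v.
    by apply: funext => n; rewrite x_lin.
  exact: seqlimD (seqlimZ _ (zP u)) (zP v).
have zs : sym_op z.
  split=> // u v; rewrite [RHS]rdotC; apply: seqlim_rdot_eq2 (zP u) (zP v) _ => n.
  by rewrite (xs n).2 rdotC.
have z1 u : rn (z u) <= rn u.
  have := @seqlim_rn_le _ _ _ _ 0 (rn u) (zP u); rewrite subr0; apply.
  by exists 0%N => i _; rewrite subr0.
have Mz : M z.
  by apply: (vna_seqlim hM Mx (C := 1) zl _ zP) => u; rewrite mul1r.
exists z; split=> // r r0; pose e j : H -> H := x j - z.
have eE j u : e j u = x j u - z u by [].
have Me j : M (e j) by apply: vnaB.
have es j : sym_op (e j).
  split; first exact: (vna_linear hM (Me j)).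
  by move=> u v; rewrite !eE rdotBl rdotBr (xs j).2 zs.2.
have e2 j u : rn (e j u) <= 2 * rn u.
  rewrite eE; apply: (le_trans (rnD _ _)); rewrite rnN.
  by have := x1 j u; have := z1 u; lra.
have edamp K j u : rn (e j (l K u)) <= 2 * K.+1%:R * 2^-1 ^+ j * rn u.
  rewrite eE rnC mulrAC; apply: (seqlim_rn_le (zP (l K u))).
  by exists j => i; apply: dist_damp.
(* The square of [e j] is split along [id = l K + (id - l K)]: [e j \o l K] is small in operator
   norm for large [j], and [id - l K] is small in 2-norm for large [K]. *)
have main K j : rn (L (e j)) ^+ 2 <= 4 * K.+1%:R * 2^-1 ^+ j + 4 * mu K.
  have Mee : M (e j \o e j) by apply: vna_comp.
  have Mel : M (e j \o l K) by apply: vna_comp.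
  have Mil : M (id - l K) by apply: vnaB.
  have ees : sym_op (e j \o e j).
    split; first exact: (vna_linear hM Mee).
    by move=> u v; rewrite /= !(es j).2.
  have -> : rn (L (e j)) ^+ 2 =
      rdot (L (e j \o l K)) (L (e j)) + rdot (L (id - l K)) (L (e j \o e j)).
    rewrite (gns_rdot hL)// (gns_rdot hL)// (gns_sqr hL)//.
    rewrite (adj_eq (sym_adjoint (es j))) (adj_eq (sym_adjoint ees)).
    rewrite -(rtrD hM hL) //; [|exact: (vna_comp hM (Me j) Mel)|
      exact: (vna_comp hM Mee Mil)].
    congr (rtr tau _); apply: funext => u; rewrite !fctE /=.
    have el := vna_linear hM (Me j).
    by rewrite (linfB el u) (linfB el (e j u)) addrC subrK.
  have Lel : rn (L (e j \o l K)) <= 2 * K.+1%:R * 2^-1 ^+ j.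
    apply: (gns_bound hM tau_state tau_normal hL Mel); last exact: edamp.
    by rewrite mulr_ge0 ?exprn_ge0 ?invr_ge0// mulr_ge0.
  have Le : rn (L (e j)) <= 2.
    by apply: (gns_bound hM tau_state tau_normal hL) => //; exact: e2.
  have Lee : rn (L (e j \o e j)) <= 4.
    apply: (gns_bound hM tau_state tau_normal hL) => // u /=.
    by have := e2 j u; have := e2 j (e j u); lra.
  (* As [0 <= id - l K <= 1], this operator dominates its square, so its squared 2-norm is at most
     its trace. *)
  have Lil : rn (L (id - l K)) <= mu K.
    rewrite -(@ler_pXn2r _ 2) ?nnegrE ?rn_ge0 ?(ltW (mu0 _))//.
    apply: le_trans (rtr_l K); rewrite (gns_sqr hL)//.
    have [[ll ls] l0] := l_psd K.
    have ip : psd (id - l K).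
      split; first split.
      - by move=> a u v; rewrite !fctE /= ll scalerBr opprD addrACA.
      - by move=> u v; rewrite !fctE /= rdotBl rdotBr ls.
      - by move=> u; rewrite !fctE /= rdotBl rdotii subr_ge0.
    rewrite (adj_eq (sym_adjoint ip.1)).
    apply: (rtr_mono hM tau_normal) => //; [exact: vna_comp| |exact: ip.1|].
      split; first exact: (vna_linear hM (vna_comp hM Mil Mil)).
      by move=> v w; rewrite /comp !ip.1.2.
    move=> v; rewrite /comp ip.1.2 rdotii.
    have := @psd_norm_le _ _ _ 1 v ip; rewrite mul1r; apply=> w; rewrite mul1r.
    by rewrite !fctE /= rdotBl rdotii lerBlDr lerDl.
  have := rdot_le (L (e j \o l K)) (L (e j)).
  have := rdot_le (L (id - l K)) (L (e j \o e j)).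
  have := ler_pM (rn_ge0 _) (rn_ge0 _) Lel Le.
  have := ler_pM (rn_ge0 _) (rn_ge0 _) Lil Lee.
  lra.
have r2 : 0 < r ^+ 2 / 8 by rewrite divr_gt0// exprn_gt0.
have [K Kr] := invn_lt r2; have {Kr} := Kr K (leqnn K); rewrite -/(mu K) => Kr.
have q : (2^-1 : R) < 1 by rewrite invf_lt1// ltr1n.
have q0 : 0 <= (2^-1 : R) by rewrite invr_ge0.
have [n nq] := geometric_to0 (4 * K.+1%:R) q0 q (divr_gt0 r2 (ltr0n R 2)).
exists n => j /nq jq; rewrite -(gnsB hM hL)// -/(e j).
suff : rn (L (e j)) ^+ 2 < r ^+ 2.
  by rewrite ltr_pXn2r ?nnegrE ?rn_ge0// ltW.
by have := main K j; move: r2 jq Kr; set E := r ^+ 2;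
   set a := 4 * K.+1%:R * _; set b := mu K; lra.
Qed.

End damping_limit.

Lemma damped_ball_limit : exists z, [/\ M z, sym_op z,
  forall u, rn (z u) <= rn u & seqlim (fun n => L (x n)) (L z)].
Proof.
have ex K : exists l, [/\ psd l, (forall u, seqlim (fun n => c (K, n) u) (l u)) &
    forall n u, rdot (l u) u <= rdot (c (K, n) u) u].
  by apply: decreasing_limit => [n|u|n u]; [exact: c_psd|exact: c_le1|exact: c_decr].
by have [l lP] := choice ex; apply: fast_ball_limit_aux lP.
Qed.

End damping.

Lemma fast_ball_limit : exists z, [/\ M z, sym_op z,
  forall u, rn (z u) <= rn u & seqlim (fun n => L (x n)) (L z)].
Proof. by have [c cP] := res_ex; apply: damped_ball_limit cP. Qed.

End fast_sequence.

Lemma sa_ball_complete (w : nat -> H -> H) : (forall n, sa_ball M (w n)) ->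
  (forall e, 0 < e -> exists n, forall i j, (n <= i)%N -> (n <= j)%N ->
    rn (L (w i) - L (w j)) < e) ->
  exists2 z, sa_ball M z & seqlim (fun n => L (w n)) (L z).
Proof.
move=> wM wC.
have ex k : exists n, forall i j, (n <= i)%N -> (n <= j)%N ->
    rn (L (w i) - L (w j)) < 4^-1 ^+ k.+1.
  by apply: wC; rewrite exprn_gt0// invr_gt0.
have [f fP] := choice ex.
(* The index [m k] is past [f k], so consecutive differences of the subsequence are at most
   [4^-1 ^+ k.+1]; strict growth brings [m] beyond any given index. *)
pose m := fix m k := if k is k'.+1 then (m k' + f k).+1 else f 0%N.
have fm k : (f k <= m k)%N by case: k => [|k] //=; rewrite leqW// leq_addl.
have wP n := (sa_ballP hM (w n)).1 (wM n).
have [||||z [Mz zs z1 zl]] := @fast_ball_limit (fun k => w (m k)).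
- by move=> n; case: (wP (m n)).
- by move=> n; case: (wP (m n)).
- by move=> n; case: (wP (m n)).
- by move=> k; apply/ltW/fP => //; rewrite (leq_trans (fm k))//= leqW// leq_addr.
exists z; first exact/(sa_ballP hM).
move=> e e0; have [n nw] := wC _ (divr_gt0 e0 (ltr0n R 2)).
have [p pz] := zl _ (divr_gt0 e0 (ltr0n R 2)).
exists n => i ni.
have km k : (k <= m k)%N.
  by elim: k => [//|k ih] /=; rewrite ltnS (leq_trans ih)// leq_addr.
have := pz (n + p)%N (leq_addl _ _).
have := nw i (m (n + p)%N) ni (leq_trans (leq_addr p n) (km _)).
by have := rn_triangle (L (w (m (n + p)%N))) (L (w i)) (L z); lra.
Qed.

End completeness.

(** * The algebra of elements of a von Neumann algebra *)

(** Bundled so that the ring structure can be declared on a type determined by [V]; [vna_nontrivial]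
    gives [1 != 0]. *)
Record vna (R : realType) (H : hilbertType R) := Vna {
  vna_set : set (H -> H);
  vnaP : von_neumann_algebra vna_set;
  vna_nontrivial : exists u : H, u != 0
}.

Definition vop (R : realType) (H : hilbertType R) (V : vna H) :=
  {x : H -> H | vna_set V x}.

Section vop_algebra.
Context {R : realType} {H : hilbertType R} {V : vna H}.
Implicit Types x y z : vop V.

Let hV := vnaP V.
Let P x : vna_set V (sval x) := svalP x.

Lemma vop_eq x y : (forall u, sval x u = sval y u) -> x = y.
Proof.
case: x y => [x hx] [y hy] /= /funext xy; case: y / xy hy => hy.
by rewrite (Prop_irrelevance hx hy).
Qed.

Let vlin x : linear (sval x) := vna_linear hV (P x).

HB.instance Definition _ := gen_eqMixin (vop V).
HB.instance Definition _ := gen_choiceMixin (vop V).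

Definition vop_add x y : vop V := exist _ (sval x + sval y) (vnaD hV (P x) (P y)).
Definition vop_opp x : vop V := exist _ (- sval x) (vnaN hV (P x)).
Definition vop_zero : vop V := exist _ 0 (vna0 hV).
Definition vop_one : vop V := exist _ id (vna_id hV).
Definition vop_mul x y : vop V :=
  exist _ (sval x \o sval y) (vna_comp hV (P x) (P y)).
(** Only real scalars act, to match the real-valued trace; the imaginary unit returns as a central
    element in [imag_unit]. *)
Definition vop_scale (a : R) x : vop V :=
  exist _ (a%:C *: sval x) (vnaZ hV _ (P x)).

Let vop_addA : associative vop_add.
Proof. by move=> x y z; apply: vop_eq => u; apply: addrA. Qed.
Let vop_addC : commutative vop_add.
Proof. by move=> x y; apply: vop_eq => u; apply: addrC. Qed.
Let vop_add0 : left_id vop_zero vop_add.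
Proof. by move=> x; apply: vop_eq => u; apply: add0r. Qed.
Let vop_addN : left_inverse vop_zero vop_opp vop_add.
Proof. by move=> x; apply: vop_eq => u; apply: addNr. Qed.

HB.instance Definition _ :=
  GRing.isZmodule.Build (vop V) vop_addA vop_addC vop_add0 vop_addN.

Let vop_mulA : associative vop_mul.
Proof. by move=> x y z; apply: vop_eq. Qed.
Let vop_mul1 : left_id vop_one vop_mul.
Proof. by move=> x; apply: vop_eq. Qed.
Let vop_1mul : right_id vop_one vop_mul.
Proof. by move=> x; apply: vop_eq. Qed.
Let vop_mulDl : left_distributive vop_mul +%R.
Proof. by move=> x y z; apply: vop_eq. Qed.
Let vop_mulDr : right_distributive vop_mul +%R.
Proof. by move=> x y z; apply: vop_eq => u; apply: linfD (vlin x) _ _. Qed.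
Let vop_one_neq0 : vop_one != 0.
Proof.
have [u /eqP u0] := vna_nontrivial V; apply/eqP => /(congr1 (fun x => sval x u)).
exact: u0.
Qed.

HB.instance Definition _ := GRing.Zmodule_isNzRing.Build (vop V)
  vop_mulA vop_mul1 vop_1mul vop_mulDl vop_mulDr vop_one_neq0.

Let vop_scaleA (a b : R) x : vop_scale a (vop_scale b x) = vop_scale (a * b) x.
Proof. by apply: vop_eq => u; rewrite /= !fctE scalerA rmorphM. Qed.
Let vop_scale1 : left_id 1 vop_scale.
Proof. by move=> x; apply: vop_eq => u; rewrite /= !fctE scale1r. Qed.
Let vop_scaleDr : right_distributive vop_scale +%R.
Proof. by move=> a x y; apply: vop_eq => u; apply: scalerDr. Qed.
Let vop_scaleDl x : {morph vop_scale^~ x : a b / a + b}.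
Proof.
by move=> a b; apply: vop_eq => u; rewrite /= !fctE rmorphD /= scalerDl.
Qed.

HB.instance Definition _ := GRing.Zmodule_isLmodule.Build R (vop V)
  vop_scaleA vop_scale1 vop_scaleDr vop_scaleDl.

Let vop_scaleAl (a : R) x y : a *: (x * y) = (a *: x) * y.
Proof. by apply: vop_eq. Qed.

HB.instance Definition _ := GRing.Lmodule_isLalgebra.Build R (vop V) vop_scaleAl.

Let vop_scaleAr (a : R) x y : a *: (x * y) = x * (a *: y).
Proof. by apply: vop_eq => u; apply/esym/(linfZ (vlin x)). Qed.

HB.instance Definition _ := GRing.Lalgebra_isAlgebra.Build R (vop V) vop_scaleAr.

Definition vop_adj x : vop V := exist _ (adj (sval x)) (vna_adj hV (P x)).2.

End vop_algebra.

(** * Irreducibility *)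

Section cartesian_decomposition.
Context {R : realType} {H : hilbertType R}.
Variable M : set (H -> H).
Hypothesis hM : von_neumann_algebra M.
Implicit Types x y m : H -> H.

Lemma sa_ball_scale x : M x -> sym_op x ->
  exists2 r : R, 0 < r & sa_ball M (r%:C *: x).
Proof.
move=> Mx xs; have [C xC] := vna_bound hM Mx.
have C1 : 0 < `|C| + 1 by rewrite ltr_wpDl.
exists (`|C| + 1)^-1; first by rewrite invr_gt0.
have Mr : M ((`|C| + 1)^-1%:C *: x) by apply: vnaZ.
apply/(sa_ballP hM); split=> //.
  split; first exact: (vna_linear hM Mr).
  by move=> u v; rewrite !fctE rdotZl rdotZr xs.2.
move=> u; rewrite !fctE rnZ gtr0_norm ?invr_gt0// mulrC ler_pdivrMr// mulrC.
apply: (le_trans (xC u)); rewrite ler_wpM2r ?rn_ge0//.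
by rewrite (le_trans (ler_norm C))// lerDl.
Qed.

Lemma sa_addr_adj x : M x -> M (x + adj x) /\ sym_op (x + adj x).
Proof.
move=> Mx; have [xx Ma] := vna_adj hM Mx; have Ms : M (x + adj x) by apply: vnaD.
split=> //; split; first exact: (vna_linear hM Ms).
move=> u v; rewrite !fctE rdotDl rdotDr addrC /rdot xx; congr (_ + _).
by rewrite -(adjoint_sym xx).
Qed.

Lemma sa_subr_adj x : M x ->
  M ('i%C *: (x - adj x)) /\ sym_op ('i%C *: (x - adj x)).
Proof.
move=> Mx; have [xx Ma] := vna_adj hM Mx.
have Ms : M ('i%C *: (x - adj x)) by apply: vnaZ => //; apply: vnaB.
split=> //; apply/(sym_opP (vna_linear hM Ms)) => u v.
rewrite !fctE hdotZl hdotZr.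
have -> : hdot (x u - adj x u) v = hdot (x u) v - hdot (adj x u) v.
  exact: linearBl.
have -> : hdot u (x v - adj x v) = hdot u (x v) - hdot u (adj x v).
  exact: linearBr.
rewrite xx -(adjoint_sym xx).
have -> : 'i%C^*%C = - 'i%C :> R[i].
  by apply/eqP; rewrite eq_complex /= oppr0 !eqxx.
by ring.
Qed.

(** The Cartesian decomposition, doubled to avoid halves. *)
Lemma vna_eq_of_sa x u : x u + x u = (x + adj x) u - 'i%C *: ('i%C *: (x - adj x)) u.
Proof.
rewrite !fctE scalerA.
have -> : 'i%C * 'i%C = -1 :> R[i] by rewrite -expr2 sqr_i.
by rewrite scaleN1r opprK addrACA subrr addr0.
Qed.

Lemma commute_sa y x : linear y -> M x ->
  (forall z, sa_ball M z -> forall u, y (z u) = z (y u)) ->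
  forall u, y (x u) = x (y u).
Proof.
move=> yl Mx yz u.
have ysa z : M z -> sym_op z -> forall v, y (z v) = z (y v).
  move=> Mz zs v; have [r r0 /yz/(_ v)] := sa_ball_scale Mz zs.
  rewrite !fctE (linfZ yl) => /(congr1 (fun w => r^-1%:C *: w)).
  by rewrite !scalerA -rmorphM /= mulVf ?gt_eqF// !scale1r.
have [Ms ss] := sa_addr_adj Mx; have [Md ds] := sa_subr_adj Mx.
have : y (x u) + y (x u) = x (y u) + x (y u).
  rewrite -(linfD yl) vna_eq_of_sa [RHS]vna_eq_of_sa (linfB yl) (linfZ yl).
  by rewrite (ysa _ Ms ss) (ysa _ Md ds).
rewrite -!mulr2n => /eqP; rewrite -subr_eq0 -mulrnBl -scaler_nat scaler_eq0.
by rewrite pnatr_eq0 /= subr_eq0 => /eqP.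
Qed.

End cartesian_decomposition.

Section irreducibility.
Context {R : realType} {H : hilbertType R}.
Variable M : set (H -> H).
Hypothesis hM : von_neumann_algebra M.
Hypothesis H_nontrivial : exists u : H, u != 0.
Implicit Types x y z : H -> H.

Definition real_scalar x := exists a : R, x = a%:C *: id.

Lemma sa_scalar y : sym_op y -> scalars y -> real_scalar y.
Proof.
move=> ys [a ya]; have [u u0] := H_nontrivial; exists (complex.Re a).
have := sym_adjoint ys u u; rewrite ya hdotZl hdotZr.
have hu : hdot u u != 0 by rewrite -hdotE expf_neq0// normr_eq0.
move=> /(mulIf hu) aa; apply: funext => v; rewrite !fctE; congr (_ *: _).
by case: a aa {ya} => p q [] ?; congr (_ +i* _); lra.
Qed.

Lemma scalars_sa_ball (S : set (H -> H)) :
  (forall y, sa_ball M y -> S y -> real_scalar y) ->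
  (forall (a : R[i]) y, S y -> S (a *: y)) ->
  forall y, M y -> S (y + adj y) -> S ('i%C *: (y - adj y)) -> scalars y.
Proof.
move=> hS SZ y My Sp Sm.
have sc z : M z -> sym_op z -> S z -> scalars z.
  move=> Mz zs Sz; have [r r0 Xz] := sa_ball_scale hM Mz zs.
  have [a za] := hS _ Xz (SZ _ _ Sz); exists (r^-1%:C * a%:C).
  have -> : z = r^-1%:C *: (r%:C *: z).
    by rewrite scalerA -rmorphM /= mulVf ?gt_eqF// scale1r.
  by rewrite za scalerA.
have [Ms ss] := sa_addr_adj hM My; have [Md ds] := sa_subr_adj hM My.
have [a ya] := sc _ Ms ss Sp; have [b yb] := sc _ Md ds Sm.
(* Read off from [vna_eq_of_sa], where the two self-adjoint parts are the scalars [a] and [b]. *)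
exists ((a - 'i%C * b) / 2); apply: funext => u.
have := vna_eq_of_sa y u; rewrite ya yb scalerA -scalerBl => h.
have h2 : 2^-1 + 2^-1 = 1 :> R[i] by field.
have -> : y u = (2^-1 : R[i]) *: (y u + y u).
  by rewrite scalerDr -scalerDl h2 scale1r.
by rewrite h scalerA mulrC.
Qed.

Lemma commutant3 (T : set (H -> H)) : (forall x, T x -> bounded_op x) ->
  commutant (commutant (commutant T)) = commutant T.
Proof.
move=> Tb; apply/seteqP; split=> x [xb xT]; split=> // y Ty.
  by apply: xT; split=> [|z [_ zT]]; [exact: Tb | rewrite zT].
by case: Ty => _ ->.
Qed.

(* Joining the commutant of [M] keeps the algebra inside [M], so that adjoints
   exist without the Riesz representation theorem. *)
Lemma subalgebra_centralizer y : M y -> sym_op y ->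
  subalgebra M (commutant ([set y] `|` commutant M)).
Proof.
move=> My ys; set T := _ `|` _.
have Mb z : M z -> bounded_op z by rewrite -hM.2 => -[].
have Tb x : T x -> bounded_op x by case=> [->|[]//]; exact: Mb.
have NM : commutant T `<=` M.
  by move=> z [zb zT]; rewrite -hM.2; split=> // w Mw; apply: zT; right.
split=> //; split; last exact: commutant3.
move=> z Nz; have Mz := NM _ Nz; have [zz Mzz] := vna_adj hM Mz.
exists (adj z) => //; split; first exact: Mb.
move=> w [->|cw]; last first.
  by apply: funext => u /=; rewrite (vna_commute _ Mzz cw).
have zy : z \o y = y \o z by case: Nz => _; apply; left.
have yy := adj_eq (sym_adjoint ys).
have := congr1 adj zy.
by rewrite (adj_comp hM Mz My) (adj_comp hM My Mz) yy => ->.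
Qed.

(** If [y] commutes with [S], it commutes with all that [S] generates, because the centralizer of
    [y] in [M] is a subalgebra. Conversely, [S] being self-adjoint, [adj y] commutes with [S]
    whenever [y] does, so the Cartesian parts of [y] are scalars. *)
Lemma irreducible_WstarP (S : set (H -> H)) : S `<=` sa_ball M ->
  irreducible M (Wstar M S) <->
  forall y, sa_ball M y -> (forall s, S s -> y \o s = s \o y) -> real_scalar y.
Proof.
move=> SX.
have SM s : S s -> M s by move=> /SX /(sa_ballP hM)[].
have WM : Wstar M S `<=` M by apply: smallest_sub => //; split.
have Mb z : M z -> bounded_op z by rewrite -hM.2 => -[].
split=> [irr y Xy yS|h].
  have [My ys _] := (sa_ballP hM y).1 Xy.
  apply: sa_scalar => //; rewrite -irr; split=> //; split; first exact: Mb.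
  move=> z Wz.
  have : commutant ([set y] `|` commutant M) z.
    apply: Wz; split; first exact: subalgebra_centralizer.
    move=> s Ss; split; first by apply/Mb/SM.
    move=> w [->|cw]; first by rewrite -yS.
    by apply: funext => u /=; rewrite (vna_commute _ (SM _ Ss) cw).
  by case=> _ zy; apply/esym/zy; left.
apply/seteqP; split=> [y [[yb yW] My]|_ [a ->]]; last first.
  have Ma : M (a *: id) by apply: vnaZ => //; apply: vna_id.
  split=> //; split; first exact: Mb.
  move=> z /WM Mz; apply: funext => u.
  exact: (esym (linfZ (vna_linear hM Mz) a u)).
have yS s : S s -> y \o s = s \o y by move=> Ss; apply: yW; apply: sub_gen_smallest.
have aS s : S s -> adj y \o s = s \o adj y.
  move=> Ss; have [Ms ss _] := (sa_ballP hM s).1 (SX _ Ss).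
  have := congr1 adj (yS _ Ss).
  by rewrite (adj_comp hM My Ms) (adj_comp hM Ms My) (adj_eq (sym_adjoint ss)).
pose C := [set z : H -> H | forall s, S s -> z \o s = s \o z].
apply: (@scalars_sa_ball C) => // [a z Cz s Ss|s Ss|s Ss].
- have sl := vna_linear hM (SM _ Ss); apply: funext => u.
  have /= sz := congr1 (@^~ u) (Cz s Ss).
  by rewrite /= !fctE (linfZ sl) -sz.
- have sl := vna_linear hM (SM _ Ss); apply: funext => u.
  have := congr1 (@^~ u) (yS s Ss); have := congr1 (@^~ u) (aS s Ss).
  by rewrite /= !fctE (linfD sl) => -> ->.
- have sl := vna_linear hM (SM _ Ss); apply: funext => u.
  have := congr1 (@^~ u) (yS s Ss); have := congr1 (@^~ u) (aS s Ss).
  by rewrite /= !fctE (linfZ sl) (linfB sl) => -> ->.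
Qed.

End irreducibility.

(** * The unit ball of a tracial von Neumann algebra *)

Section standard_form.
Context {R : realType} {H : hilbertType R}.
Variables (V : vna H) (tau : (H -> H) -> R[i]).
Let M := vna_set V.
Let hM : von_neumann_algebra M := vnaP V.
Hypotheses (tau_state : state M tau) (tau_normal : normal M tau).
Hypotheses (tau_faithful : faithful M tau) (tau_tracial : tracial M tau).
Variables (L2 : hilbertType R) (L : (H -> H) -> L2).
Hypothesis hL : is_L2 M tau L.
Implicit Types x y z : vop V.

Let MP x : M (sval x) := svalP x.

Definition vop_tr x : R := rtr tau (sval x).
Definition vop_nrm x : R := rn (L (sval x)).
Definition vop_ball : set (vop V) := [set x | sa_ball M (sval x)].

Let vop_inj x y : sval x = sval y -> x = y.
Proof. by move=> xy; apply: vop_eq => u; rewrite xy. Qed.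

Let nrmBE x y : vop_nrm (x - y) = rn (L (sval x) - L (sval y)).
Proof. by rewrite -(gnsB hM hL). Qed.

Let ballP x : vop_ball x ->
  sym_op (sval x) /\ forall u, rn (sval x u) <= rn u.
Proof. by move=> /(sa_ballP hM)[]. Qed.

Hypothesis M_center : M `&` commutant M = scalars.

Lemma vop_tracial_ball : tracial_ball (@vop_adj _ _ V) vop_tr vop_nrm vop_ball.
Proof.
have Mid := vna_id hM.
split.
- by move=> x y; apply: vop_inj; apply: (adjD hM (MP x) (MP y)).
- by move=> a x; apply: vop_inj; rewrite /= -(adj_scale hM a (MP x)).
- by move=> x y; apply: vop_inj; apply: (adj_comp hM (MP x) (MP y)).
- by move=> x; apply: vop_inj; apply: (adjK hM (MP x)).
- by move=> x y; apply: (rtrD hM hL (MP x) (MP y)).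
- by move=> a x; apply: (rtrZ hM hL a (MP x)).
- exact: (rtr_id tau_state).
- by move=> x y; rewrite /vop_tr /rtr (tau_tracial (MP x) (MP y)).
- by move=> x; apply: (rtr_adj hM hL (MP x)).
- by move=> x; apply: rn_ge0.
- by move=> x; apply: (gns_sqr hL (MP x)).
- move=> x /rn_eq0 Lx; apply: vop_eq => u.
  by rewrite (gns_eq0 tau_faithful hL (MP x) Lx).
- by move=> x y; rewrite /vop_nrm (gnsD hL)//; apply: rnD.
- by move=> a x; rewrite /vop_nrm (gnsZ hM hL)//; apply: rnZ.
- move=> x y; have := rdot_CS (L (sval x)) (L (sval y)).
  by rewrite (gns_rdot hL).
- move=> x /ballP[xs _]; apply: vop_inj; exact/adj_eq/sym_adjoint.
- move=> a x y /ballP[xs x1] /ballP[ys y1] /andP[a0 a1].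
  apply/(sa_ballP hM); split; first exact: MP.
    split; first exact: (vna_linear hM (MP _)).
    move=> u v; rewrite /= !fctE !rdotDl !rdotDr !rdotZl !rdotZr.
    by rewrite xs.2 ys.2.
  move=> u; rewrite /= !fctE; apply: (le_trans (rnD _ _)); rewrite !rnZ.
  have b0 : 0 <= 1 - a by rewrite subr_ge0.
  rewrite (ger0_norm a0) (ger0_norm b0).
  have := ler_wpM2l a0 (x1 u); have := ler_wpM2l b0 (y1 u); lra.
(* As [x] is a contraction, the form of [adj d \o x \o x \o d] lies below that of [adj d \o d]. *)
- move=> x d Xx; have [xs x1] := ballP Xx.
  rewrite -(@ler_pXn2r _ 2) ?nnegrE ?rn_ge0// !(gns_sqr hL)//.
  have [[ds' Mds] dl] := (vna_adj hM (MP d), vna_linear hM (MP d)).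
  rewrite /= (adj_comp hM (MP x) (MP d)) (adj_eq (sym_adjoint xs)).
  have dE u v : rdot (adj (sval d) u) v = rdot u (sval d v).
    by rewrite rdotC (rdotC u) /rdot -ds'.
  have M1 : M ((adj (sval d) \o sval x) \o (sval x \o sval d)).
    by do 2!apply: (vna_comp hM).
  have M2 : M (adj (sval d) \o sval d) by apply: (vna_comp hM).
  apply: (rtr_mono hM tau_normal) => //.
  + split; first exact: (vna_linear hM M1).
    by move=> u v; rewrite /= dE !xs.2 [RHS]rdotC dE rdotC.
  + split; first exact: (vna_linear hM M2).
    by move=> u v; rewrite /= dE [RHS]rdotC dE rdotC.
  + move=> u; rewrite /= !dE xs.2 !rdotii.
    by rewrite ler_pXn2r ?nnegrE ?rn_ge0.
- move=> x sx; have xE : adj (sval x) = sval x by have := congr1 sval sx.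
  have xs : sym_op (sval x).
    by have /(sa_partP hM)[] : sa_part M (sval x) by split.
  by have [r r0 Xr] := sa_ball_scale hM (MP x) xs; exists r.
- move=> w wX wC.
  have [|z Xz wz] := sa_ball_complete hM tau_state tau_normal tau_faithful hL
    (w := fun n => sval (w n)) wX.
    by move=> e /wC[n wn]; exists n => i j ni nj; rewrite -nrmBE; apply: wn.
  have Mz : M z by have [] := (sa_ballP hM z).1 Xz.
  exists (exist _ z Mz) => // e /wz[n wn]; exists n => i /wn.
  by rewrite nrmBE.
(* Commuting with the ball forces commuting with [M] by [commute_sa]; the center then gives a
   complex scalar, and symmetry makes it real. *)
- move=> y Xy yc; have [ys _] := ballP Xy.
  have yl := vna_linear hM (MP y).
  have : real_scalar (sval y).
    apply: (sa_scalar (vna_nontrivial V) ys); rewrite -M_center.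
    have My := MP y; split=> //; split; first by move: My; rewrite -hM.2 => -[].
    move=> m Mm; apply: funext => u; apply: (commute_sa hM yl Mm) => z Xz v.
    have Mz : M z by have [] := (sa_ballP hM z).1 Xz.
    have := yc (exist _ z Mz) Xz.
    by move=> /(congr1 (fun w => sval w v)).
  by move=> [a ya]; exists a; apply: vop_inj.
- have MJ : M ('i%C *: id) by apply: (vnaZ hM).
  exists (exist _ ('i%C *: id) MJ); split.
  + apply: vop_eq => u; have : 'i%C *: ('i%C *: u) = - u.
      by rewrite scalerA -expr2 sqr_i scaleN1r.
    exact.
  + apply: vop_inj; apply: adj_eq => u v; rewrite /= !fctE hdotZl.
    rewrite -scaleNr hdotZr rmorphN; congr (_ * _).
    by apply/eqP; rewrite eq_complex /= oppr0 opprK !eqxx.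
  + move=> x; apply: vop_eq => u.
    by rewrite /= !fctE (linfZ (vna_linear hM (MP x))).
Qed.

Variable D : set L2.
Hypotheses (D_countable : countable D) (D_dense : dense D).

(** The net consists of preimages under [L] of the closed balls about [g k] of radius [m.+1%:R^-1],
    with [j] coding the pair [(k, m)]. *)
Lemma vop_ball_net : exists P, ball_net vop_nrm vop_ball P.
Proof.
have [g gD] : exists g, set_surj [set: nat] D g by apply/pcard_surjP.
(* The default pair serves the codes that [unpickle] rejects; it does no harm, as every such ball is
   convex and closed. *)
pose P j : set (vop V) := let: (k, m) := odflt (0%N, 0%N) (unpickle j) in
  [set y | rn (L (sval y) - g k) <= m.+1%:R^-1].
exists P; split.
- move=> j a x y; rewrite /P; case: (odflt _ _) => k m /= xk yk /andP[a0 a1].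
  have b0 : 0 <= 1 - a by rewrite subr_ge0.
  have -> : L (sval (a *: x + (1 - a) *: y)) - g k =
      a%:C *: (L (sval x) - g k) + (1 - a)%:C *: (L (sval y) - g k).
    have MZ b z : M (b%:C *: sval z) by apply: vnaZ.
    rewrite /= (gnsD hL (MZ _ x) (MZ _ y)) !(gnsZ hM hL)//.
    rewrite !scalerBr addrACA -opprD -scalerDl -rmorphD /= subrKC.
    by rewrite scale1r.
  apply: (le_trans (rnD _ _)); rewrite !rnZ (ger0_norm a0) (ger0_norm b0).
  have := ler_wpM2l a0 xk; have := ler_wpM2l b0 yk.
  by set r := _^-1; lra.
- move=> j x; rewrite /P; case: (odflt _ _) => k m /= xcl.
  apply/ler_addgt0Pr => e /xcl[y yk]; rewrite nrmBE.
  have := rn_triangle (L (sval y)) (L (sval x)) (g k).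
  by rewrite (rnC (L (sval x)) (L (sval y))); set r := _^-1 in yk *; lra.
- move=> y e Xy e0.
  have [m /(_ m (leqnn m)) me] := invn_lt (divr_gt0 e0 (ltr0n R 2)).
  have m0 : (0 : R[i]) < (m.+1%:R^-1)%:C by rewrite ltcR invr_gt0.
  have [||z [zb Dz]] := D_dense (O := ball (L (sval y)) (m.+1%:R^-1)%:C).
  + by exists (L (sval y)); apply: ballxx.
  + exact: ball_open.
  have [k _ gk] := gD z Dz.
  have yk : rn (L (sval y) - g k) <= m.+1%:R^-1.
    by move: zb; rewrite -ball_normE /= rnE ltcR gk => /ltW.
  exists (pickle (k, m)); rewrite /P pickleK /=; split=> // y' y'k.
  rewrite nrmBE; have := rn_triangle (g k) (L (sval y)) (L (sval y')).
  rewrite (rnC (g k)); move: me yk y'k; set r := _^-1; lra.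
Qed.

End standard_form.

(** * Tuples of operators in the 2-norm metric *)

Theorem theorem1 (R : realType) (H : hilbertType R) (M : set (H -> H))
    (tau : (H -> H) -> R[i])
    (M_II1 : II1_factor M)
    (tau_state : state M tau) (tau_normal : normal M tau)
    (tau_faithful : faithful M tau) (tau_tracial : tracial M tau)
    (M_separable : separable_algebra M tau)
    (n : nat) (n_ge2 : (2 <= n)%N) :
  let A : set (dist_space (@dist2 R H M tau n)) :=
    [set x | irreducible M (Wstar M (range (fun i : 'I_n => \val (x i))))] in
  dense A /\ Gdelta A.
Proof.
move=> A; have [[hM nontriv center] _ _] := M_II1.
have [L2 [L [hL [D [Dc Dd]]]]] := M_separable.
pose V := Vna hM nontriv.
have hX : tracial_ball (@vop_adj _ _ V) (vop_tr tau) (vop_nrm L) (@vop_ball _ _ V).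
  exact: (@vop_tracial_ball _ _ V).
have [P hP] := @vop_ball_net _ _ V tau L2 L hL D Dc Dd.
set N := vop_nrm L in hX hP; set X := @vop_ball _ _ V in hX hP.
have valX (z : sa_ball M) : sa_ball M (\val z) by apply: set_mem; apply: valP.
have valM (z : sa_ball M) : M (\val z) by have [] := (sa_ballP hM _).1 (valX z).
pose up (z : sa_ball M) : vop V := exist _ (\val z) (valM z).
have upX z : X (up z) by apply: valX.
have down (h : vop V) : X h -> exists z : sa_ball M, up z = h.
  move=> Xh; have Xh' : sa_ball M (sval h) := Xh.
  by exists (SigSub (mem_set Xh')); apply: vop_eq.
have normE z z' : norm2 tau (\val z - \val z') = N (up z - up z').
  by rewrite (norm2E hL)//; apply: vnaB.
(* Positivity of [e] takes care of the initial value 0 of the maximum. *)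
have distP (x y : 'I_n -> sa_ball M) e : 0 < e ->
    (@dist2 R H M tau n x y < e) <-> forall i, N (up (x i) - up (y i)) < e.
  move=> e0; rewrite /dist2; split.
    by move=> /bigmax_ltP[_ h] i; rewrite -normE; apply: h.
  by move=> h; apply/bigmax_ltP; split=> // i _; rewrite normE.
have AP (x : 'I_n -> sa_ball M) :
    A x <-> only_scalars_commute X (fun i => up (x i)).
  have range_ball : range (fun i : 'I_n => \val (x i)) `<=` sa_ball M.
    by move=> _ [i _ <-].
  rewrite /A /= (irreducible_WstarP hM nontriv range_ball); split=> h.
    move=> y Xy yx; have [|a ya] := h (sval y) Xy.
      move=> _ [i _ <-]; have /comm_eq0 := yx i.
      by move=> /(congr1 sval).
    by exists a; apply: vop_eq => u; rewrite ya.
  move=> y Xy yx; have My : M y by have [] := (sa_ballP hM _).1 Xy.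
  have [|a ya] := h (exist _ y My) Xy.
    move=> i; apply/eqP; rewrite subr_eq0; apply/eqP; apply: vop_eq => u.
    exact: (congr1 (@^~ u) (yx _ (ex_intro2 _ _ i Logic.I erefl))).
  by exists a; have := congr1 sval ya.
split.
  move=> O [x Ox] /(_ x Ox)[e e0 eO].
  (* Only the first two coordinates are perturbed; [2 <= n] provides them. *)
  pose i0 := Ordinal (ltnW n_ge2); pose i1 := Ordinal n_ge2.
  have [h1 [h2 [Xh1 Xh2 h1x h2x irr]]] :=
    dense_irreducible_pair hX hP (upX (x i0)) (upX (x i1)) e0.
  have [[z1 z1h] [z2 z2h]] := (down _ Xh1, down _ Xh2).
  pose x' i := if i == i0 then z1 else if i == i1 then z2 else x i.
  exists x'; split.
    apply: eO; apply/distP => // i; rewrite /x'.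
    have sym (y z : vop V) : N (y - z) = N (z - y).
      by rewrite -[y - z]opprB -scaleN1r (nrmZ hX) normrN1 mul1r.
    case: eqP => [->|_]; first by rewrite sym z1h.
    case: eqP => [->|_]; first by rewrite sym z2h.
    by rewrite subrr -(scale0r (0 : vop V)) (nrmZ hX) normr0 mul0r.
  apply/AP => y Xy yx'; apply: irr => //.
    by have := yx' i0; rewrite /x' eqxx z1h.
  by have := yx' i1; rewrite /x' /= z2h.
(* By [only_scalars_commuteP] the intersection of these open sets is [A]. *)
pose U j : set (dist_space (@dist2 R H M tau n)) :=
  [set x | net_condition X P j (fun i => up (x i))].
exists U.
  move=> j; suff : dist_open (U j) by [].
  move=> x xj.
  have [|e e0 he] := net_condition_open hX hP _ xj; first by move=> i.
  by exists e => // y /distP xy; apply: he => // i; apply: xy.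
apply/seteqP; split=> x.
  by move=> /AP /(only_scalars_commuteP hX hP) h j _; apply: h.
by move=> h; apply/AP/(only_scalars_commuteP hX hP) => j; apply: h.
Qed.
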